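(* Let $0<\alpha,\beta<1$, and let $\Theta=(\Theta_{ij})$ be a Hermitian $2\times2$ matrix corresponding to a non-degenerate operator $\boldsymbol A_\Theta$ (as defined in the context). The eigenvector $f_n^\Theta\in L^2(\mu^\Theta)$ of $\boldsymbol A_\Theta$ corresponding to the eigenvalue $\lambda_n^\Theta=(-z_n-1)(-z_n+\alpha+\beta)$ takes the following form in the spectral representation: $$f_n^\Theta(x)=\chi_{\{\lambda_n^\Theta\}}(x)\begin{pmatrix}1-\Theta_{12}c_2(z_n)\\ \Theta_{11}c_2(z_n)+c_4(z_n)\end{pmatrix}.$$ The space $L^2(\mu^\Theta)=\operatorname{clos}\operatorname{span}\{f_n^\Theta:n\in\mathbb N_0\}$.
   Context: **Operators.** Let $p(x)=(1-x)^{\alpha+1}(1+x)^{\beta+1}$, $\ell_{\alpha,\beta}[f](x)=-\frac{1}{(1-x)^\alpha(1+x)^\beta}[p(x)f'(x)]'$ in $\mathcal H=L^2[(-1,1),(1-x)^\alpha(1+x)^\beta]$, and $\mathcal D_{\max}^{(\alpha,\beta)}=\{f\in\mathcal H: f,f'\in AC_{loc}(-1,1),\ \ell_{\alpha,\beta}[f]\in\mathcal H\}$. For $f\in\mathcal D_{\max}^{(\alpha,\beta)}$ put $$f^{[0]}(-1)=\lim_{x\to-1^+}-p(x)f'(x),\qquad f^{[0]}(1)=\lim_{x\to1^-}p(x)f'(x),$$ $$f^{[1]}(-1)=\lim_{x\to-1^+}\Big(-f(x)-\tfrac{(1+x)f'(x)}{\beta}\Big),\qquad f^{[1]}(1)=\lim_{x\to1^-}\Big(f(x)-\tfrac{(1-x)f'(x)}{\alpha}\Big),$$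 and $\Gamma_0f=(f^{[0]}(-1),f^{[0]}(1))^\top$, $\Gamma_1f=(f^{[1]}(-1),-f^{[1]}(1))^\top$. For a Hermitian matrix $\Theta$, $\boldsymbol A_\Theta$ is the self-adjoint operator acting by $\ell_{\alpha,\beta}$ on $\{f\in\mathcal D_{\max}^{(\alpha,\beta)}:\Theta\Gamma_0f=\Gamma_1f\}$; $\boldsymbol A_\infty$ acts by $\ell_{\alpha,\beta}$ on $\ker\Gamma_0$. All have discrete spectrum. The eigenvalues of $\boldsymbol A_\Theta$ are denoted $\lambda_n^\Theta$, $n\in\mathbb N_0$. **Special functions:** $$c_1(z)=\frac{-\Gamma(\alpha+1)\Gamma(-\beta)}{\Gamma(-z+\alpha)\Gamma(z-\beta+1)},\quad c_2(z)=\frac{\beta2^{\alpha+\beta+1}\Gamma(\alpha+1)\Gamma(\beta)}{\Gamma(z+1)\Gamma(-z+\alpha+\beta)},\quad c_4(z)=\frac{\beta\Gamma(1-\alpha)\Gamma(\beta)}{\alpha\Gamma(z-\alpha+1)\Gamma(-z+\beta)}.$$ **Weyl functions and spectral measure.** With $\lambda=(-z-1)(-z+\alpha+\beta)$, $M_\infty(\lambda)=\frac1{c_2(z)}\begin{pmatrix}-c_4(z)&1\\1&-c_1(z)\end{pmatrix}$ is the Weyl $m$-function associated with $\boldsymbol A_\infty$ and $M_\Theta(\lambda)=(\Theta-M_\infty(\lambda))^{-1}$ that of $\boldsymbol A_\Theta$. $\mu^\Theta$ is the matrix-valued spectral measure of $\boldsymbol A_\Theta$ with respect to the cyclic set $\{\widetilde\delta_1,\widetilde\delta_{-1}\}$,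 where $\langle f,\widetilde\delta_{-1}\rangle=\lim_{x\to-1^+}-p(x)f'(x)$ and $\langle f,\widetilde\delta_1\rangle=\lim_{x\to1^-}p(x)f'(x)$; it is related to $M_\Theta$ by $\mu^\Theta\{\lambda\}=-i\lim_{\varepsilon\searrow0}\varepsilon M_\Theta(\lambda+i\varepsilon)$. The eigenvalues are given implicitly by $(\Theta_{11}c_2(z)+c_4(z))(\Theta_{22}c_2(z)+c_1(z))-(\Theta_{12}c_2(z)-1)(\Theta_{21}c_2(z)-1)=0$, and $z_n$ is the value corresponding to $\lambda_n^\Theta$. **Degeneracy.** An eigenvalue $\lambda_n^\Theta\in\rho(\boldsymbol A_\infty)$ of $\boldsymbol A_\Theta$ is degenerate if for the corresponding $z_n\in\mathbb R$ with $\lambda_n^\Theta=(-z_n-1)(-z_n+\alpha+\beta)$ we have $\Theta_{11}=-\frac{c_4(z_n)}{c_2(z_n)}$, $\Theta_{21}=\frac1{c_2(z_n)}$ and $\Theta_{22}=-\frac{c_1(z_n)}{c_2(z_n)}$. $\boldsymbol A_\Theta$ is non-degenerate if all of its eigenvalues are non-degenerate; it is then assumed that all eigenvalues of $\boldsymbol A_\Theta$ are simple, i.e. $\mu^\Theta\{x\}$ has rank one at $x=\lambda_n^\Theta$ and rank zero for all other $x$. **Spectral representation.** $L^2(\mu^\Theta)$ is the space of $\mathbb C^2$-valued functions with inner product $\int_{\mathbb R}\langle d\mu^\Theta(x)\varphi(x),\psi(x)\rangle_{\mathbb C^2}$; $\boldsymbol A_\Theta$ is unitarily equivalent to multiplication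 by the independent variable on it, and the eigenvector ''in the spectral representation'' is the eigenvector of this multiplication operator (unique only up to a nonzero scalar). $\chi_S$ is the characteristic function of $S$.
   Formalization: The eigenvector claim is stated for each n whose displayed vector is nonzero, and density of the span when all are nonzero (a non-degenerate Θ can make one vanish, and the claim then fails); the boundary condition is ΘΓ₀f = ±Γ₁f, since the printed sign of Γ₁ conflicts with M_Θ. *)

(* Defs.v *)
From HB Require Import structures.
From mathcomp Require Import all_boot all_order all_algebra.
From mathcomp Require Import sesquilinear spectral.
From mathcomp Require Import complex.
From mathcomp Require Import all_classical all_reals all_analysis.

Set Implicit Arguments.
Unset Strict Implicit.
Unset Printing Implicit Defensive.

Import Order.TTheory GRing.Theory Num.Theory.
Import numFieldNormedType.Exports.

Local Open Scope classical_set_scope.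
Local Open Scope ring_scope.
Local Open Scope complex_scope.
Local Open Scope sesquilinear_scope.

Section ComplexValued.
Variable R : realType.
Implicit Types (f : R -> R[i]).

(* Convergence, limits, derivatives and integrals of complex-valued functions
   are taken componentwise: R[i] carries no topology here. *)
Definition ccvg {T : Type} (F : set_system T) (g : T -> R[i]) (l : R[i]) : Prop :=
  (fun t => complex.Re (g t)) @ F --> complex.Re l /\
  (fun t => complex.Im (g t)) @ F --> complex.Im l.

Definition clim {T : Type} (F : set_system T) (g : T -> R[i]) : R[i] :=
  lim ((fun t => complex.Re (g t)) @ F) +i* lim ((fun t => complex.Im (g t)) @ F).

Definition cderiv f (x : R) : R[i] :=
  derive1 (fun y => complex.Re (f y)) x +i* derive1 (fun y => complex.Im (f y)) x.

Definition cintegral (tau : {measure set R -> \bar R}) f : R[i] :=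
  Rintegral tau setT (fun x => complex.Re (f x))
    +i* Rintegral tau setT (fun x => complex.Im (f x)).

Definition cmeasurable (D : set R) f : Prop :=
  measurable_fun D (fun x => complex.Re (f x)) /\
  measurable_fun D (fun x => complex.Im (f x)).

Definition cnorm2 (w : R[i]) : R := complex.Re w ^+ 2 + complex.Im w ^+ 2.

(* The disjoint subintervals ]s i, t i[ of [a, b] are listed from left to
   right. *)
Definition abs_continuous (a b : R) (g : R -> R) : Prop :=
  forall e : R, 0 < e -> exists2 d : R, 0 < d &
    forall (n : nat) (s t : nat -> R),
      (forall i, (i < n)%N -> [/\ a <= s i, s i <= t i & t i <= b]) ->
      (forall i, (i.+1 < n)%N -> t i <= s i.+1) ->
      \sum_(i < n) (t i - s i) < d ->
      \sum_(i < n) `|g (t i) - g (s i)| < e.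

(* AC_loc(-1, 1) *)
Definition ac_loc f : Prop :=
  forall a b : R, -1 < a -> a < b -> b < 1 ->
    abs_continuous a b (fun x => complex.Re (f x)) /\
    abs_continuous a b (fun x => complex.Im (f x)).

Definition cderivable f : Prop :=
  forall x : R, -1 < x < 1 ->
    derivable (fun y => complex.Re (f y)) x 1 /\
    derivable (fun y => complex.Im (f y)) x 1.

End ComplexValued.

Section GammaFunction.
Variable R : realType.

(* m ^ (- z) for m > 0 *)
Definition cpowN (m : nat) (z : R[i]) : R[i] :=
  let t := ln (m%:R : R) in
  (expR (- complex.Re z * t))%:C *
  (cos (complex.Im z * t) +i* (- sin (complex.Im z * t))).

(* The entire function 1 / Gamma, by Gauss's product formula
   1 / Gamma(z) = lim_m m ^ (- z) z (z + 1) ... (z + m) / m!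
   (with m = n + 1 to avoid ln 0). *)
Definition rGamma (z : R[i]) : R[i] :=
  clim \oo (fun n : nat =>
    cpowN n.+1 z * (\prod_(k < n.+2) (z + k%:R)) / (n.+1`!)%:R).

Definition Gamma (z : R[i]) : R[i] := (rGamma z)^-1.

End GammaFunction.

Definition cvec2 (R : realType) (a b : R[i]) : 'cV[R[i]]_2 :=
  \col_(i < 2) (if i == 0 then a else b).

Definition mx2 (R : realType) (a b c d : R[i]) : 'M[R[i]]_2 :=
  \matrix_(i < 2, j < 2)
    (if i == 0 then if j == 0 then a else b else if j == 0 then c else d).

Section JacobiOperators.
Context {R : realType}.
Variables alpha beta : R.
Implicit Types (f g : R -> R[i]) (l : R[i]) (dom : set (R -> R[i])).

Definition jweight (x : R) : R := (1 - x) `^ alpha * (1 + x) `^ beta.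

Definition jp (x : R) : R := (1 - x) `^ (alpha + 1) * (1 + x) `^ (beta + 1).

Definition jell f (x : R) : R[i] :=
  - ((jweight x)^-1)%:C * cderiv (fun y => (jp y)%:C * cderiv f y) x.

Definition jinterval : set R := `]-1, 1[.

Definition H_norm2 f : \bar R :=
  (\int[lebesgue_measure]_(x in jinterval) (cnorm2 (f x) * jweight x)%:E)%E.

(* Elements of L^2 spaces are represented by functions; equality in
   L^2((-1, 1), w) is eqH. *)
Definition inH f : Prop := cmeasurable jinterval f /\ (H_norm2 f < +oo)%E.

Definition eqH f g : Prop :=
  {ae (lebesgue_measure : set R -> \bar R),
    forall x : R, -1 < x < 1 -> f x = g x}.

Definition Dmax : set (R -> R[i]) :=
  [set f | [/\ inH f, cderivable f, ac_loc f, ac_loc (cderiv f) & inH (jell f)]].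

Definition f0m f : R[i] := clim (at_right (-1)) (fun x => - ((jp x)%:C * cderiv f x)).
Definition f0p f : R[i] := clim (at_left 1) (fun x => (jp x)%:C * cderiv f x).
Definition f1m f : R[i] :=
  clim (at_right (-1)) (fun x => - f x - (1 + x)%:C * cderiv f x / beta%:C).
Definition f1p f : R[i] :=
  clim (at_left 1) (fun x => f x - (1 - x)%:C * cderiv f x / alpha%:C).

Definition Gamma0 f : 'cV[R[i]]_2 := cvec2 (f0m f) (f0p f).
Definition Gamma1 f : 'cV[R[i]]_2 := cvec2 (f1m f) (- f1p f).

(* All the operators act by jell, so an operator is given by its domain.

   The sign s (equal to 1 or -1) is the orientation of Gamma1.  For s = 1 the
   boundary condition is Theta Gamma0 f = Gamma1 f.  However, Green's formula
   here reads
     <l f, g> - <f, l g> = <Gamma0 f, Gamma1 g> - <Gamma1 f, Gamma0 g>,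
   and the matrix Minf below satisfies Gamma1 f = - Minf Gamma0 f on solutions
   of l f = lambda f: for alpha = beta = 1/2, lambda = -1 (z = 0), the solution
   f (cos t) = t / sin t has Gamma0 f = (pi, 0)^T, Gamma1 f = (1, -1)^T, and
   Minf Gamma0 f = (-1, 1)^T.  So (Theta - Minf)^-1 is the Weyl function of
   the operator with s = -1.  Keeping s arbitrary covers both orientations. *)
Definition dom_Theta (s : R) (Theta : 'M[R[i]]_2) : set (R -> R[i]) :=
  [set f | Dmax f /\ Theta *m Gamma0 f = s%:C *: Gamma1 f].

Definition dom_inf : set (R -> R[i]) := [set f | Dmax f /\ Gamma0 f = 0].

Definition eigenfunction dom l f : Prop :=
  [/\ dom f, ~ eqH f (fun=> 0) & eqH (jell f) (fun x => l * f x)].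

Definition eigenvalue_of dom l : Prop := exists f, eigenfunction dom l f.

Definition resolvent_set dom l : Prop :=
  (forall g, inH g ->
     exists2 f, dom f & eqH (fun x => jell f x - l * f x) g) /\
  (exists2 C : R, 0 < C & forall f, dom f ->
     (H_norm2 f <= C%:E * H_norm2 (fun x => jell f x - l * f x)%R)%E).

Definition finite_multiplicity dom l : Prop :=
  exists (k : nat) (g : 'I_k -> R -> R[i]),
    forall f, eigenfunction dom l f ->
      exists a : 'I_k -> R[i], eqH f (fun x => \sum_(i < k) a i * g i x).

Definition isolated_in_spectrum dom l : Prop :=
  exists2 r : R, 0 < r & forall l' : R[i],
    l' != l -> cnorm2 (l' - l) < r -> resolvent_set dom l'.

Definition discrete_spectrum dom : Prop :=
  forall l, ~ resolvent_set dom l ->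
    [/\ eigenvalue_of dom l, isolated_in_spectrum dom l
      & finite_multiplicity dom l].

Definition lambda_of (z : R[i]) : R[i] := (- z - 1) * (- z + alpha%:C + beta%:C).

Definition c1 (z : R[i]) : R[i] :=
  - Gamma (alpha%:C + 1) * Gamma (- beta%:C)
  * rGamma (- z + alpha%:C) * rGamma (z - beta%:C + 1).

Definition c2 (z : R[i]) : R[i] :=
  beta%:C * (2 `^ (alpha + beta + 1))%:C * Gamma (alpha%:C + 1) * Gamma beta%:C
  * rGamma (z + 1) * rGamma (- z + alpha%:C + beta%:C).

Definition c4 (z : R[i]) : R[i] :=
  beta%:C * Gamma (1 - alpha%:C) * Gamma beta%:C / alpha%:C
  * rGamma (z - alpha%:C + 1) * rGamma (- z + beta%:C).

(* M_infinity at lambda_of z; c1, c2, c4 take the same values at the two roots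
   z and alpha + beta - 1 - z of lambda_of z = lambda. *)
Definition Minf (z : R[i]) : 'M[R[i]]_2 :=
  (c2 z)^-1 *: mx2 (- c4 z) 1 1 (- c1 z).

(* M (lambda) = (Theta - M_infinity (lambda))^-1 off the real axis *)
Definition weyl_function (Theta : 'M[R[i]]_2) (M : R[i] -> 'M[R[i]]_2) : Prop :=
  forall z : R[i], complex.Im (lambda_of z) != 0 ->
    (Theta - Minf z) *m M (lambda_of z) = 1%:M.

Definition degenerate_ev (s : R) (Theta : 'M[R[i]]_2) l : Prop :=
  [/\ eigenvalue_of (dom_Theta s Theta) l, resolvent_set dom_inf l &
    exists z : R, [/\ l = lambda_of z%:C,
      Theta 0 0 = - (c4 z%:C / c2 z%:C),
      Theta 1 0 = (c2 z%:C)^-1 &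
      Theta 1 1 = - (c1 z%:C / c2 z%:C)]].

Definition nondegenerate_op (s : R) (Theta : 'M[R[i]]_2) : Prop :=
  forall l, eigenvalue_of (dom_Theta s Theta) l -> ~ degenerate_ev s Theta l.

End JacobiOperators.

(* A locally finite matrix-valued measure mu in polar form d mu = D d tau, with
   tau = tr mu its trace measure and D >= 0 of trace 1. *)
Record matrix_measure (R : realType) := MatrixMeasure {
  mm_trace : {measure set R -> \bar R};
  mm_dens : R -> 'M[R[i]]_2;
  mm_locally_finite : forall a b : R, (mm_trace `[a, b]%classic < +oo)%E;
  mm_measurable : forall i j, cmeasurable setT (fun x => mm_dens x i j);
  mm_psd : forall (x : R) (v : 'cV[R[i]]_2),
    0 <= (v ^t* *m mm_dens x *m v) 0 0;
  mm_tr1 : forall x, \tr (mm_dens x) = 1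
}.

Section L2MatrixMeasure.
Variable R : realType.
Variable mu : matrix_measure R.
Local Notation tau := (mm_trace mu).
Local Notation D := (mm_dens mu).
Implicit Types (phi psi : R -> 'cV[R[i]]_2).

Definition atom (x : R) : 'M[R[i]]_2 := (fine (tau [set x]))%:C *: D x.

(* the inner product \int < d mu phi, psi > of L^2(mu) *)
Definition L2_inner phi psi : R[i] :=
  cintegral tau (fun x => ((psi x) ^t* *m D x *m phi x) 0 0).

(* its squared norm, as an extended real *)
Definition L2_norm2 phi : \bar R :=
  (\int[tau]_x (complex.Re (((phi x) ^t* *m D x *m phi x) 0 0))%:E)%E.

Definition L2_mem phi : Prop :=
  (forall i, cmeasurable setT (fun x => phi x i 0)) /\ (L2_norm2 phi < +oo)%E.

Definition L2_eq phi psi : Prop :=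
  {ae tau, forall x, D x *m phi x = D x *m psi x}.

Definition mulvar phi : R -> 'cV[R[i]]_2 := fun x => x%:C *: phi x.

Definition mul_eigenvector (l : R) phi : Prop :=
  [/\ L2_mem phi, L2_mem (mulvar phi), ~ L2_eq phi (fun=> 0)
    & L2_eq (mulvar phi) (fun x => l%:C *: phi x)].

Definition closed_span (f : nat -> R -> 'cV[R[i]]_2) : set (R -> 'cV[R[i]]_2) :=
  [set phi | L2_mem phi /\ forall e : R, 0 < e ->
     exists (N : nat) (a : nat -> R[i]),
       (L2_norm2 (fun x => phi x - \sum_(k < N) a k *: f k x)%R < (e ^+ 2)%:E)%E].

End L2MatrixMeasure.

(* mu is the spectral measure of the operator with domain dom with respect to
   the cyclic set of the functionals delta_{-1}, delta_1: a unitary U from H to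
   L^2(mu) turns the operator into multiplication by the independent variable
   and delta_{-1}, delta_1 into the constants (1, 0)^T, (0, 1)^T. *)
Definition spectral_measure (R : realType) (alpha beta : R)
    (dom : set (R -> R[i])) (mu : matrix_measure R) : Prop :=
  exists U : (R -> R[i]) -> (R -> 'cV[R[i]]_2),
  [/\ [/\ forall f, inH alpha beta f -> L2_mem mu (U f),
          forall (c : R[i]) f g, inH alpha beta f -> inH alpha beta g ->
            L2_eq mu (U (fun x => c * f x + g x)) (fun x => c *: U f x + U g x),
          forall f, inH alpha beta f -> L2_norm2 mu (U f) = H_norm2 alpha beta f
        & forall phi, L2_mem mu phi ->
            exists2 f, inH alpha beta f & L2_eq mu (U f) phi],
      forall f, inH alpha beta f ->
        (exists2 g, dom g & eqH f g) <-> L2_mem mu (mulvar (U f)),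
      forall f, dom f -> L2_eq mu (U (jell alpha beta f)) (mulvar (U f))
    & forall f, dom f ->
        f0m alpha beta f = L2_inner mu (U f) (fun=> cvec2 1 0) /\
        f0p alpha beta f = L2_inner mu (U f) (fun=> cvec2 0 1)].

Definition eigvec (R : realType) (alpha beta : R) (Theta : 'M[R[i]]_2)
    (z : R[i]) : 'cV[R[i]]_2 :=
  cvec2 (1 - Theta 0 1 * c2 alpha beta z)
        (Theta 0 0 * c2 alpha beta z + c4 alpha beta z).

(* Main.v *)
(** The first row of c2 (Theta - M_infinity) is orthogonal to the vector v_n of
the theorem.  Along a path z(e) -> z_n with lambda(z(e)) = lambda_n + i e one has
c2 (Theta - M_infinity) (e M_Theta) = e c2 -> 0, so by continuity of c1, c2, c4
that row annihilates the atom of mu at lambda_n: the columns of the atom are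
multiples of v_n.  For a density D of trace one this gives D v_n = v_n and
D p \in <v_n> for all p, whence the eigenvector and its uniqueness.  The
continuity of 1/Gamma, and the fact that it vanishes only at the nonpositive
integers, come from Gauss's products converging uniformly on bounded sets,
with a relative error.

For completeness, the resolvent bound at a real point x that is not an
eigenvalue, transported to L^2(mu) and tested with indicators of small
intervals around x, shows that mu vanishes near x.  So mu is carried by the
countable set of the lambda_n, and dominated convergence concludes. *)

Require Import Defs.
From HB Require Import structures.
From mathcomp Require Import all_boot all_order all_algebra.
From mathcomp Require Import sesquilinear spectral.
From mathcomp Require Import complex.
From mathcomp Require Import all_classical all_reals all_analysis.
From mathcomp Require Import measurable_realfun ring lra.

Set Implicit Arguments.
Unset Strict Implicit.
Unset Printing Implicit Defensive.

Import Order.TTheory GRing.Theory Num.Theory.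
Import numFieldNormedType.Exports.

Local Open Scope classical_set_scope.
Local Open Scope ring_scope.
Local Open Scope complex_scope.

(** * Elementary real bounds *)

Section RealBounds.
Variable R : realType.
Implicit Types s t : R.

(** From exp(- s) >= 1 - s one gets (exp s - 1 - s)(1 - s) <= s^2, and 1 - s >= 1/2. *)
Lemma expR_taylor1 s : `|s| <= 1/2 -> `|expR s - 1 - s| <= 2 * s ^+ 2.
Proof.
rewrite ler_norml => /andP[s1 s2].
have h1 := expR_ge1Dx s; have h2 := expR_ge1Dx (- s).
have h3 := expRxMexpNx_1 s; have h4 := expR_gt0 s.
have h5 : expR s * (1 - s) <= expR s * expR (- s) by rewrite ler_pM2l.
rewrite h3 in h5.
have h6 : 0 <= expR s - 1 - s by lra.
rewrite (ger0_norm h6).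
have h7 : 0 <= (expR s - 1 - s) * (1/2 - s) by rewrite mulr_ge0//; lra.
rewrite expr2; nra.
Qed.

(** The three trigonometric bounds form a chain: parity reduces to s > 0, and the mean value theorem
    derives each from the one before. *)
Lemma norm_sin_le s : `|sin s| <= `|s|.
Proof.
wlog s0 : s / 0 < s => [hw|].
  have [s0|s0|->] := ltgtP s 0; last by rewrite sin0.
  - by have := hw (- s); rewrite sinN !normrN oppr_gt0; exact.
  - exact: hw.
have [c _ ] : exists2 c, c \in `]0, s[ & sin s - sin 0 = cos c * (s - 0).
  by apply: (MVT (f := sin) (df := cos)) => //;
    apply: continuous_subspaceT; exact: continuous_sin.
rewrite sin0 !subr0 => ->; rewrite normrM -[leRHS]mul1r ler_wpM2r//.
exact: cos_max.
Qed.

Lemma cos_taylor0 s : `|cos s - 1| <= s ^+ 2.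
Proof.
wlog s0 : s / 0 < s => [hw|].
  have [s0|s0|->] := ltgtP s 0; last by rewrite cos0 subrr normr0 sqr_ge0.
  - by have := hw (- s); rewrite cosN sqrrN oppr_gt0; exact.
  - exact: hw.
have [c] : exists2 c, c \in `]0, s[ & cos s - cos 0 = - sin c * (s - 0).
  by apply: (MVT (f := cos) (df := - sin)) => //;
    apply: continuous_subspaceT; exact: continuous_cos.
rewrite in_itv/= => /andP[c0 cs].
rewrite cos0 !subr0 => ->; rewrite normrM normrN expr2 (gtr0_norm s0).
rewrite ler_wpM2r ?(ltW s0)// (le_trans (norm_sin_le c))// gtr0_norm//.
exact: ltW.
Qed.

Lemma sin_taylor1 s : `|s| <= 1 -> `|sin s - s| <= s ^+ 2.
Proof.
wlog s0 : s / 0 < s => [hw|].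
  have [s0|s0|->] := ltgtP s 0; last by rewrite sin0 subrr normr0 sqr_ge0.
  - move=> sle; have := hw (- s).
    by rewrite sinN -opprD !normrN sqrrN oppr_gt0; exact.
  - exact: hw.
rewrite (gtr0_norm s0) => s1.
have [c] : exists2 c, c \in `]0, s[ &
    (sin s - s) - (sin 0 - 0) = (cos c - 1) * (s - 0).
  apply: (MVT (f := fun x : R => sin x - x) (df := fun x : R => cos x - 1)) => //.
  apply: continuous_subspaceT => x.
  by apply: cvgB; [exact: continuous_sin | exact: cvg_id].
rewrite in_itv/= => /andP[c0 cs].
rewrite sin0 !subr0 => ->; rewrite normrM expr2 (gtr0_norm s0).
rewrite ler_wpM2r ?(ltW s0)// (le_trans (cos_taylor0 c))//; nra.
Qed.

(** Here t is the step of log m in Gauss's product. Both bounds are ln(1 + x) <= x, at x = - u, as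
    (n + 1)/(n + 2) = 1 - u, and at x = 1/(n + 1) = u/(1 - u). *)
Lemma ln_ratio_bounds (n : nat) (u := (n.+2%:R : R)^-1)
    (t := ln (n.+2%:R : R) - ln (n.+1%:R : R)) :
  [/\ 0 < u, u <= 1/2, u <= t & t <= u + 2 * u ^+ 2].
Proof.
have n1 : 0 < n.+1%:R :> R by [].
have n2 : n.+2%:R = n.+1%:R + 1 :> R by rewrite -natr1.
have u0 : 0 < u by rewrite invr_gt0.
have u2 : u <= 1/2 by rewrite mul1r lef_pV2 ?posrE// ler_nat.
have nu : n.+1%:R * u = 1 - u.
  by rewrite /u n2; field; rewrite gt_eqF// n2 ltr_wpDr.
split=> //.
- have := @le_ln1Dx R (- u); rewrite ltrN2 => /(_ ltac:(lra)).
  rewrite -nu lnM ?posrE// lnV ?posrE// /t; lra.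
- have -> : t = ln (1 + n.+1%:R^-1).
    rewrite /t -ln_div ?posrE//; congr ln; rewrite n2; field; exact: lt0r_neq0.
  apply: (le_trans (le_ln1Dx _)).
    by rewrite (lt_trans (_ : -1 < 0))// ?ltrN10// invr_gt0.
  have vu : n.+1%:R^-1 * (1 - u) = u.
    by rewrite -nu mulrA mulVf ?mul1r// lt0r_neq0.
  have v0 : 0 < n.+1%:R^-1 :> R by rewrite invr_gt0.
  move: (n.+1%:R^-1) vu v0 => v vu v0.
  have v1 : 0 <= v * (1/2 - u) by rewrite mulr_ge0 ?subr_ge0// ltW.
  have v2 : 0 <= u * (2 * u - v) by rewrite mulr_ge0 ?(ltW u0)//; lra.
  rewrite expr2; lra.
Qed.

End RealBounds.

Local Notation normc := ComplexField.Normc.normc.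

(** * The modulus and the factors of Gauss's product *)

Section ComplexModulus.
Variable R : realType.
Implicit Types (z w : R[i]) (x t : R).

Lemma normc_ge0 z : 0 <= normc z.
Proof. by case: z => a b; rewrite /= sqrtr_ge0. Qed.

Lemma normcD_le z w : normc (z + w) <= normc z + normc w.
Proof. exact: (@le_normcD R z w). Qed.

Lemma normc_opp z : normc (- z) = normc z.
Proof. exact: (@normcN R z). Qed.

Lemma normcB_le z w : normc (z - w) <= normc z + normc w.
Proof. by rewrite (le_trans (normcD_le _ _))// normc_opp. Qed.

Lemma normcD_leB z w : normc z <= normc (z - w) + normc w.
Proof. by have := normcD_le (z - w) w; rewrite subrK. Qed.

Lemma normc_real x : normc x%:C = `|x|.
Proof. by rewrite /= expr0n/= addr0 sqrtr_sqr. Qed.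

Lemma normc_Re z : `|complex.Re z| <= normc z.
Proof.
case: z => a b /=; rewrite -sqrtr_sqr ler_wsqrtr// lerDl; exact: sqr_ge0.
Qed.

Lemma normc_Im z : `|complex.Im z| <= normc z.
Proof.
case: z => a b /=; rewrite -sqrtr_sqr ler_wsqrtr// lerDr; exact: sqr_ge0.
Qed.

Lemma normc_le_ReIm z : normc z <= `|complex.Re z| + `|complex.Im z|.
Proof.
case: z => a b /=; rewrite -(ler_pXn2r (n := 2)) ?nnegrE ?sqrtr_ge0 ?addr_ge0//.
rewrite sqr_sqrtr ?addr_ge0 ?sqr_ge0// -(real_normK (num_real a)).
rewrite -(real_normK (num_real b)).
have := normr_ge0 a; have := normr_ge0 b; rewrite !expr2; nra.
Qed.

Lemma ReB z w : complex.Re (z - w) = complex.Re z - complex.Re w.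
Proof. by case: z => ? ?; case: w. Qed.

Lemma ImB z w : complex.Im (z - w) = complex.Im z - complex.Im w.
Proof. by case: z => ? ?; case: w. Qed.

(* exp(- t z) *)
Definition cexpN t z : R[i] :=
  (expR (- complex.Re z * t))%:C *
  (cos (complex.Im z * t) +i* (- sin (complex.Im z * t))).

Lemma cexpND s t z : cexpN (s + t) z = cexpN s z * cexpN t z.
Proof.
rewrite /cexpN !mulrDr expRD cosD sinD /=; case: z => x y /=.
apply/eqP; rewrite eq_complex /=; apply/andP; split; apply/eqP; ring.
Qed.

Lemma cexpN_neq0 t z : cexpN t z != 0.
Proof.
rewrite mulf_neq0//; first by rewrite eq_complex/= expR_eq0.
rewrite eq_complex/= negb_and oppr_eq0 -negb_and; apply/negP => /andP[].
move=> /eqP c0 /eqP s0; have := cos2Dsin2 (complex.Im z * t).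
by rewrite c0 s0 expr0n/= addr0 => /eqP; rewrite eq_sym oner_eq0.
Qed.

(** With q = |z| t, the real part of the error is at most 2q^2 + 2q^2 and the imaginary part at most
    2q^2 + q^2, whence the 7. *)
Lemma cexpN_taylor1 t z : 0 <= t -> normc z * t <= 1/2 ->
  normc (cexpN t z - (1 - t%:C * z)) <= 7 * (normc z * t) ^+ 2.
Proof.
move=> t0; set q := normc z * t => q2; have q0 : 0 <= q.
  by rewrite mulr_ge0// normc_ge0.
set x := - complex.Re z * t; set y := complex.Im z * t.
have xq : `|x| <= q.
  by rewrite normrM normrN (ger0_norm t0) ler_wpM2r// normc_Re.
have yq : `|y| <= q by rewrite normrM (ger0_norm t0) ler_wpM2r// normc_Im.
have sq a : `|a| <= q -> a ^+ 2 <= q ^+ 2.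
  by move=> aq; rewrite -(real_normK (num_real a)) ler_pXn2r ?nnegrE.
have r1 := expR_taylor1 (le_trans xq q2).
have r2 := cos_taylor0 y.
have r3 := @sin_taylor1 _ y (le_trans yq (ltac:(lra) : q <= 1)).
have r4 : `|sin y| <= q := le_trans (norm_sin_le y) yq.
have x2 := sq _ xq; have y2 := sq _ yq.
rewrite expr2 in x2 y2 *.
have qq : q * q <= q / 2 by nra.
have a1 : `|expR x - 1| <= 2 * q.
  move: r1 xq; rewrite !ler_norml !expr2 => /andP[? ?] /andP[? ?].
  apply/andP; split; lra.
have a2 : `|expR x| <= 2.
  move: a1; rewrite !ler_norml => /andP[? ?]; apply/andP; split; lra.
apply: (le_trans (normc_le_ReIm _)).
have -> : complex.Re (cexpN t z - (1 - t%:C * z)) =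
    (expR x - 1 - x) + expR x * (cos y - 1).
  by rewrite /cexpN -/x -/y /x; case: (z) => a b /=; ring.
have -> : complex.Im (cexpN t z - (1 - t%:C * z)) =
    - ((expR x - 1) * sin y) - (sin y - y).
  by rewrite /cexpN -/x -/y /y; case: (z) => a b /=; ring.
have b1 : `|expR x * (cos y - 1)| <= 2 * (q * q).
  by rewrite normrM ler_pM// (le_trans r2).
have b2 : `|- ((expR x - 1) * sin y)| <= 2 * q * q.
  by rewrite normrN normrM ler_pM.
have := ler_normD (expR x - 1 - x) (expR x * (cos y - 1)).
have := ler_normB (- ((expR x - 1) * sin y)) (sin y - y).
rewrite !expr2 in r1 r3; lra.
Qed.

(** The quotient of consecutive Gauss products is 1 + O(u^2), because the first-order terms - t z
    and u z almost cancel. The terms u - t, t u and the Taylor remainder contribute at most 2K, 2K^2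
    and 56K^2 times u^2. *)
Lemma gauss_factor_bound (K t u : R) z : 0 <= K -> normc z <= K ->
  0 <= u -> u <= 1/2 -> u <= t -> t <= u + 2 * u ^+ 2 -> 4 * K * u <= 1 ->
  normc (cexpN t z * (1 + u%:C * z) - 1) <= (4 * K + 60 * K ^+ 2) * u ^+ 2.
Proof.
move=> K0 zK u0 u2 ut tu Ku; have z0 := normc_ge0 z.
have t2 : t <= 2 * u by move: tu; rewrite expr2; nra.
have t0 : 0 <= t by lra.
have zt : normc z * t <= 2 * (K * u).
  by rewrite mulrCA; apply: ler_pM.
have zt0 : 0 <= normc z * t by rewrite mulr_ge0.
have zt2 : normc z * t <= 1/2 by rewrite -mulrA in Ku; lra.
have e7 := cexpN_taylor1 t0 zt2.
set e := cexpN t z - _ in e7.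
have -> : cexpN t z * (1 + u%:C * z) - 1 =
    (u - t)%:C * z - (t * u)%:C * (z * z) + e * (1 + u%:C * z).
  rewrite /e rmorphB rmorphM; ring.
have h1 : normc ((u - t)%:C * z) <= 2 * u ^+ 2 * K.
  rewrite ComplexField.Normc.normcM normc_real ler_pM// ler_norml; lra.
have h2 : normc ((t * u)%:C * (z * z)) <= (2 * u * u) * (K * K).
  rewrite !ComplexField.Normc.normcM normc_real normrM (ger0_norm t0) (ger0_norm u0).
  rewrite !ler_pM// ?mulr_ge0//; by rewrite ler_pM.
have h3 : normc (1 + u%:C * z) <= 2.
  rewrite (le_trans (normcD_le _ _))// -[1]/(1%:C) normc_real normr1.
  rewrite ComplexField.Normc.normcM normc_real (ger0_norm u0).
  have : u * normc z <= u * K by rewrite ler_wpM2l.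
  nra.
have h4 : normc e <= 28 * ((K * u) * (K * u)).
  apply: (le_trans e7); rewrite expr2.
  have : (normc z * t) * (normc z * t) <= 2 * (K * u) * (2 * (K * u)) by rewrite ler_pM.
  lra.
have h5 : normc (e * (1 + u%:C * z)) <= 28 * ((K * u) * (K * u)) * 2.
  by rewrite ComplexField.Normc.normcM ler_pM// ?normc_ge0.
have := normcD_le ((u - t)%:C * z - (t * u)%:C * (z * z)) (e * (1 + u%:C * z)).
have := normcB_le ((u - t)%:C * z) ((t * u)%:C * (z * z)).
have : 0 <= K * u ^+ 2 by rewrite mulr_ge0// sqr_ge0.
have : 0 <= K ^+ 2 * u ^+ 2 by rewrite mulr_ge0// sqr_ge0.
rewrite !expr2 in h1 *; lra.
Qed.

End ComplexModulus.

(** * Limits of complex-valued functions *)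

Section ComplexLimits.
Variable R : realType.
Context {T : Type} {F : set_system T} {FF : ProperFilter F}.
Implicit Types (f g : T -> R[i]) (a b : R[i]).

(** Passes from the componentwise definition to the modulus, in which all estimates are made. *)
Lemma ccvgP f a :
  ccvg F f a <-> forall e : R, 0 < e -> \forall t \near F, normc (f t - a) < e.
Proof.
split=> [[/cvgrPdist_lt f1 /cvgrPdist_lt f2] e e0|h].
  have e2 : 0 < e / 2 by rewrite divr_gt0.
  near=> t.
  apply: (le_lt_trans (normc_le_ReIm _)); rewrite ReB ImB.
  have : `|complex.Re a - complex.Re (f t)| < e / 2 by near: t; exact: f1.
  have : `|complex.Im a - complex.Im (f t)| < e / 2 by near: t; exact: f2.
  rewrite distrC => ?; rewrite distrC => ?; lra.
split; apply/cvgrPdist_lt => e /h; apply: filterS => t; apply: le_lt_trans;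
  rewrite distrC -?ReB -?ImB; [exact: normc_Re | exact: normc_Im].
Unshelve. all: by end_near. Qed.

Lemma ccvg_cst a : ccvg F (fun=> a) a.
Proof. by split; exact: cvg_cst. Qed.

Lemma ccvgD f g a b : ccvg F f a -> ccvg F g b ->
  ccvg F (fun t => f t + g t) (a + b).
Proof.
have ReD (z w : R[i]) : complex.Re (z + w) = complex.Re z + complex.Re w.
  by case: z => ? ?; case: w.
have ImD (z w : R[i]) : complex.Im (z + w) = complex.Im z + complex.Im w.
  by case: z => ? ?; case: w.
move=> [f1 f2] [g1 g2]; split.
- by under eq_fun do rewrite ReD; rewrite ReD; exact: cvgD.
- by under eq_fun do rewrite ImD; rewrite ImD; exact: cvgD.
Qed.

Lemma ccvgN f a : ccvg F f a -> ccvg F (fun t => - f t) (- a).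
Proof.
have ReN (z : R[i]) : complex.Re (- z) = - complex.Re z by case: z.
have ImN (z : R[i]) : complex.Im (- z) = - complex.Im z by case: z.
move=> [f1 f2]; split.
- by under eq_fun do rewrite ReN; rewrite ReN; exact: cvgN.
- by under eq_fun do rewrite ImN; rewrite ImN; exact: cvgN.
Qed.

Lemma ccvgM f g a b : ccvg F f a -> ccvg F g b ->
  ccvg F (fun t => f t * g t) (a * b).
Proof.
have ReM (z w : R[i]) : complex.Re (z * w) =
    complex.Re z * complex.Re w - complex.Im z * complex.Im w.
  by case: z => ? ?; case: w.
have ImM (z w : R[i]) : complex.Im (z * w) =
    complex.Re z * complex.Im w + complex.Im z * complex.Re w.
  by case: z => ? ?; case: w.
move=> [f1 f2] [g1 g2]; split.
- by under eq_fun do rewrite ReM; rewrite ReM; apply: cvgB; exact: cvgM.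
- by under eq_fun do rewrite ImM; rewrite ImM; apply: cvgD; exact: cvgM.
Qed.

Lemma ccvg_prod n (f : 'I_n -> T -> R[i]) (a : 'I_n -> R[i]) :
  (forall i, ccvg F (f i) (a i)) ->
  ccvg F (fun t => \prod_(i < n) f i t) (\prod_(i < n) a i).
Proof.
elim: n f a => [|n IH] f a fa.
  by under eq_fun do rewrite big_ord0; rewrite big_ord0; exact: ccvg_cst.
under eq_fun do rewrite big_ord_recl; rewrite big_ord_recl.
by apply: ccvgM => //; apply: IH.
Qed.

Lemma ccvg_unique f a b : ccvg F f a -> ccvg F f b -> a = b.
Proof.
move=> [f1 f2] [g1 g2]; apply/eqP; rewrite eq_complex; apply/andP; split.
- by apply/eqP; exact: (cvg_unique _ f1 g1).
- by apply/eqP; exact: (cvg_unique _ f2 g2).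
Qed.

Lemma ccvg_cexpN (s : R) f a : ccvg F f a ->
  ccvg F (fun t => cexpN s (f t)) (cexpN s a).
Proof.
move=> [f1 f2]; apply: ccvgM; split=> /=.
- apply: continuous_cvg; first exact: continuous_expR.
  by apply: cvgM; [exact: cvgN | exact: cvg_cst].
- exact: cvg_cst.
- apply: continuous_cvg; first exact: continuous_cos.
  by apply: cvgM; [|exact: cvg_cst].
- apply: cvgN; apply: continuous_cvg; first exact: continuous_sin.
  by apply: cvgM; [|exact: cvg_cst].
Qed.

End ComplexLimits.

(** * The reciprocal Gamma function *)

Section GaussProduct.
Variable R : realType.
Implicit Types (z w : R[i]) (m n : nat) (K e : R).

(** The sequence whose limit is [rGamma z]; its index n stands for m = n + 1 in Gauss's formula. *)
Definition gauss_prod z n : R[i] :=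
  cpowN n.+1 z * (\prod_(k < n.+2) (z + k%:R)) / (n.+1`!)%:R.

Lemma gauss_prodS z n (u := (n.+2%:R : R)^-1)
    (t := ln (n.+2%:R : R) - ln (n.+1%:R : R)) :
  gauss_prod z n.+1 = gauss_prod z n * (cexpN t z * (1 + u%:C * z)).
Proof.
rewrite /gauss_prod big_ord_recr/= factS natrM invfM.
have -> : cpowN n.+2 z = cpowN n.+1 z * cexpN t z.
  rewrite -[cpowN n.+1 z]/(cexpN (ln (n.+1%:R : R)) z) -cexpND.
  by rewrite /t addrC subrK.
have n2 : (n.+2%:R : R[i]) != 0 by rewrite pnatr_eq0.
have -> : 1 + u%:C * z = (z + n.+2%:R) / n.+2%:R.
  by rewrite /u fmorphV rmorph_nat; field.
ring.
Qed.

Lemma gauss_prod_eq0 z n : gauss_prod z n = 0 -> exists k, z = - k%:R.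
Proof.
move/eqP; rewrite 2!mulf_eq0 invr_eq0 pnatr_eq0 (gtn_eqF (fact_gt0 _)) orbF.
rewrite -[cpowN n.+1 z]/(cexpN (ln (n.+1%:R : R)) z) (negPf (cexpN_neq0 _ _))/=.
by move=> /prodf_eq0[k _]; rewrite addr_eq0 => /eqP; exists k.
Qed.

Lemma ccvg_gauss_prod T (F : set_system T) {FF : ProperFilter F}
    (f : T -> R[i]) z n :
  ccvg F f z -> ccvg F (fun t => gauss_prod (f t) n) (gauss_prod z n).
Proof.
move=> fz; apply: ccvgM; last exact: ccvg_cst.
apply: ccvgM; first exact: (ccvg_cexpN _ fz).
by apply: ccvg_prod => i; apply: ccvgD => //; exact: ccvg_cst.
Qed.

(* 1 / (n + 2) ^ 2 <= 1 / (n + 1) - 1 / (n + 2) makes the errors telescope. *)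
Lemma gauss_prod_tail K e : 0 <= K -> 0 < e -> exists m0, forall z m n,
  normc z <= K -> (m0 <= m)%N -> (m <= n)%N ->
  normc (gauss_prod z n - gauss_prod z m) <= e * normc (gauss_prod z m).
Proof.
move=> K0 e0; pose C := 4 * K + 60 * K ^+ 2.
have C0 : 0 <= C by rewrite addr_ge0 ?mulr_ge0// sqr_ge0.
(* Once m + 1 > B, the three summands give in turn 4 K u <= 1, 2 C/(m + 1) <= 1 and 2 C/(m + 1) <=
   e. *)
pose B := 4 * K + 2 * C + 2 * C / e.
have B0 : 0 <= B by rewrite !addr_ge0// ?mulr_ge0// invr_ge0 ltW.
exists (Num.bound B) => z m n zK m0m mn.
have Bm : B < m.+1%:R.
  apply: lt_le_trans (archi_boundP B0) _.
  by rewrite ler_nat (leq_trans m0m).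
have m1 : 0 < m.+1%:R :> R by [].
have Ce : 0 <= 2 * C / e by rewrite mulr_ge0 ?mulr_ge0// invr_ge0 ltW.
set Pm := normc (gauss_prod z m); have Pm0 : 0 <= Pm := normc_ge0 _.
have CB : 2 * C / m.+1%:R <= 1.
  rewrite ler_pdivrMr// mul1r; rewrite /B in Bm; lra.
have CBe : 2 * C / m.+1%:R <= e.
  rewrite ler_pdivrMr//; apply: ltW; rewrite -ltr_pdivrMl// mulrC.
  rewrite /B in Bm; lra.
(* The bound is sharpened to a telescoping one so that induction on n goes through. *)
suff H : normc (gauss_prod z n - gauss_prod z m) <=
    2 * C * (m.+1%:R^-1 - n.+1%:R^-1) * Pm.
  apply: (le_trans H); rewrite ler_wpM2r// (le_trans _ CBe)//.
  by rewrite ler_wpM2l ?mulr_ge0// gerBl invr_ge0.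
elim: n mn => [|n IH] mn.
  by move: mn; rewrite leqn0 => /eqP->; rewrite !subrr mulr0 mul0r /= expr0n addr0 sqrtr0.
move: mn; rewrite leq_eqVlt => /predU1P[->|].
  by rewrite !subrr mulr0 mul0r /= expr0n addr0 sqrtr0.
rewrite ltnS => mn; have {}IH := IH mn.
have [u0 u2 ut tu] := ln_ratio_bounds R n.
set u := n.+2%:R^-1 in u0 u2 ut tu *.
have Ku : 4 * K * u <= 1.
  rewrite ler_pdivrMr// mul1r (le_trans _ (_ : m.+1%:R <= _)) ?ler_nat//.
  - rewrite /B in Bm; lra.
  - by rewrite ltnS (leq_trans mn).
have step := gauss_factor_bound K0 zK (ltW u0) u2 ut tu Ku.
set r := cexpN _ _ * _ in step.
have -> : gauss_prod z n.+1 - gauss_prod z m =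
    (gauss_prod z n - gauss_prod z m) + gauss_prod z n * (r - 1).
  by rewrite gauss_prodS -/u -/r; ring.
apply: (le_trans (normcD_le _ _)); rewrite ComplexField.Normc.normcM.
(* By induction the n-th product is at most twice the m-th; this is the factor 2 in 2 C. *)
have Pn : normc (gauss_prod z n) <= 2 * Pm.
  apply: (le_trans (normcD_leB _ (gauss_prod z m))); rewrite -/Pm.
  rewrite mulrDl mul1r lerD2r (le_trans IH)// -[leRHS]mul1r.
  rewrite ler_wpM2r// (le_trans _ CB)//.
  by rewrite ler_wpM2l ?mulr_ge0// gerBl invr_ge0.
have uu : u ^+ 2 <= n.+1%:R^-1 - u.
  have n1 : 0 < n.+1%:R :> R by [].
  have n2 : n.+2%:R = n.+1%:R + 1 :> R by rewrite -natr1.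
  have nu : n.+1%:R * u = 1 - u.
    by rewrite /u n2; field; rewrite gt_eqF// n2 ltr_wpDr.
  have vu : n.+1%:R^-1 * (1 - u) = u.
    by rewrite -nu mulrA mulVf ?mul1r// lt0r_neq0.
  have v0 : 0 < n.+1%:R^-1 :> R by rewrite invr_gt0.
  move: (n.+1%:R^-1) vu v0 => v vu v0; rewrite expr2.
  have : 0 <= u * (v - u) by rewrite mulr_ge0 ?(ltW u0)//; nra.
  nra.
have h : normc (gauss_prod z n) * normc (r - 1) <=
    2 * Pm * (C * (n.+1%:R^-1 - u)).
  rewrite ler_pM// ?normc_ge0// (le_trans step)// ler_wpM2l//.
apply: (le_trans (lerD IH h)); rewrite le_eqVlt; apply/orP; left.
apply/eqP; ring.
Qed.

End GaussProduct.

(** * Convergence of Gauss's products, zeros and continuity of 1/Gamma *)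

Section ReciprocalGamma.
Variable R : realType.
Implicit Types (z w : R[i]) (m n : nat) (K e : R).

Lemma cvg_seq_cauchy (u : nat -> R) :
  (forall e, 0 < e -> exists N, forall n, (N <= n)%N -> `|u n - u N| < e) ->
  cvg (u @ \oo).
Proof.
move=> h; apply/cauchy_cvgP/cauchy_exP => e /h[N uN].
by exists (u N); exists N => // n /= Nn; rewrite /ball/= distrC uN.
Qed.

(** The tail estimate with e = 1 bounds the products, so that relative errors become absolute ones
    and the sequence is Cauchy. Only then is the [lim] in [rGamma] a true limit. *)
Lemma ccvg_rGamma z : ccvg \oo (gauss_prod z) (rGamma z).
Proof.
have [m0 h0] := gauss_prod_tail (normc_ge0 z) (@ltr01 R).
pose b := 2 * normc (gauss_prod z m0) + 1.
have b0 : 0 < b by rewrite ltr_wpDl// mulr_ge0// normc_ge0.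
have hb m : (m0 <= m)%N -> normc (gauss_prod z m) <= b.
  move=> m0m; have := h0 z m0 m (lexx _) (leqnn _) m0m.
  have := normcD_leB (gauss_prod z m) (gauss_prod z m0).
  rewrite mul1r /b; lra.
have h e : 0 < e -> exists N, forall n, (N <= n)%N ->
    normc (gauss_prod z n - gauss_prod z N) < e.
  move=> e0; have e1 : 0 < e / (2 * b) by rewrite divr_gt0// mulr_gt0.
  have [m1 h1] := gauss_prod_tail (normc_ge0 z) e1.
  exists (maxn m0 m1) => n mn.
  apply: le_lt_trans (h1 _ _ _ (lexx _) (leq_maxr _ _) mn) _.
  apply: le_lt_trans (_ : _ <= e / (2 * b) * b) _.
    by rewrite ler_wpM2l ?(ltW e1)// hb// leq_maxl.
  by rewrite invfM mulrA divfK ?gt_eqF// gtr_pMr// invf_lt1// ltr1n.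
split; apply: cvg_seq_cauchy => e /h[N hN]; exists N => n /hN;
  apply: le_lt_trans; [rewrite -ReB; exact: normc_Re|rewrite -ImB; exact: normc_Im].
Qed.

(** The tail estimate with n sent to infinity. It stays uniform on bounded sets, for continuity, and
    relative, for the location of zeros. *)
Lemma rGamma_tail K e : 0 <= K -> 0 < e -> exists m0, forall z m,
  normc z <= K -> (m0 <= m)%N ->
  normc (rGamma z - gauss_prod z m) <= e * normc (gauss_prod z m).
Proof.
move=> K0 e0; have e2 : 0 < e / 2 by rewrite divr_gt0.
have [m0 h] := gauss_prod_tail K0 e2; exists m0 => z m zK m0m.
apply/ler_addgt0Pr => d d0.
have /ccvgP /(_ _ d0) := ccvg_rGamma z => near_d.
near \oo => n.
have h1 : normc (gauss_prod z n - rGamma z) < d by near: n.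
have mn : (m <= n)%N by near: n; exact: nbhs_infty_ge.
have h2 := h z m n zK m0m mn.
have -> : rGamma z - gauss_prod z m =
  (gauss_prod z n - gauss_prod z m) - (gauss_prod z n - rGamma z) by ring.
have := normcB_le (gauss_prod z n - gauss_prod z m) (gauss_prod z n - rGamma z).
have := normc_ge0 (gauss_prod z m); have := e0; nra.
Unshelve. all: by end_near. Qed.

(** If the limit is 0, a relative error of 1/2 forces a finite product to vanish, and its zeros are
    explicit. *)
Lemma rGamma_eq0 z : rGamma z = 0 -> exists k, z = - k%:R.
Proof.
have e0 : 0 < 1 / 2 :> R by lra.
have [m0 h] := rGamma_tail (normc_ge0 z) e0 => z0.
apply: (@gauss_prod_eq0 _ z m0); apply: ComplexField.Normc.eq0_normc.
have := h z m0 (lexx _) (leqnn _); rewrite z0 sub0r normc_opp.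
have := normc_ge0 (gauss_prod z m0) => a b; apply/eqP.
rewrite eq_le a andbT; lra.
Qed.

(** A uniform limit of continuous functions is continuous: two tails and the variation of the m-th
    product, for one fixed m, are each at most e/4. *)
Lemma ccvg_rGamma_comp T (F : set_system T) {FF : ProperFilter F}
    (f : T -> R[i]) z :
  ccvg F f z -> ccvg F (fun t => rGamma (f t)) (rGamma z).
Proof.
move=> fz; apply/ccvgP => e e0.
pose K := normc z + 1; have K0 : 0 <= K by rewrite addr_ge0// normc_ge0.
have [m0 h0] := gauss_prod_tail K0 (@ltr01 R).
(* A common bound for the products of index at least m0, at every w in the ball whose m0-th product
   is within 1 of the one at z. *)
pose b := 2 * (normc (gauss_prod z m0) + 1).
have b0 : 0 < b by rewrite mulr_gt0// ltr_wpDl// normc_ge0.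
have hb w m : normc w <= K -> (m0 <= m)%N ->
    normc (gauss_prod w m0) <= normc (gauss_prod z m0) + 1 ->
    normc (gauss_prod w m) <= b.
  move=> wK m0m wz; have := h0 w m0 m wK (leqnn _) m0m.
  have := normcD_leB (gauss_prod w m) (gauss_prod w m0).
  rewrite mul1r /b; lra.
have e1 : 0 < e / (4 * b) by rewrite divr_gt0// mulr_gt0.
have [m1 h1] := rGamma_tail K0 e1.
pose m := maxn m0 m1.
have eb : e / (4 * b) * b = e / 4.
  by rewrite invfM -!mulrA mulVf ?mulr1// gt_eqF.
have zK : normc z <= K by rewrite lerDl.
have hz : normc (gauss_prod z m) <= b.
  by apply: hb; rewrite ?leq_maxl// lerDl.
have tail w : normc w <= K -> normc (gauss_prod w m) <= b ->
    normc (rGamma w - gauss_prod w m) <= e / 4.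
  move=> wK wb; apply: le_trans (h1 _ _ wK (leq_maxr _ _)) _.
  by rewrite -eb ler_wpM2l// ltW.
have /ccvgP c0 := @ccvg_gauss_prod _ _ _ FF f z m0 fz.
have /ccvgP cm := @ccvg_gauss_prod _ _ _ FF f z m fz.
move/ccvgP : (fz) => cf.
near=> t.
have t1 : normc (f t - z) < 1 by near: t; exact: cf.
have t2 : normc (gauss_prod (f t) m0 - gauss_prod z m0) < 1 by near: t; exact: c0.
have t3 : normc (gauss_prod (f t) m - gauss_prod z m) < e / 4.
  by near: t; apply: cm; rewrite divr_gt0.
have tK : normc (f t) <= K.
  by apply: (le_trans (normcD_leB _ z)); rewrite addrC lerD2l ltW.
have tb : normc (gauss_prod (f t) m) <= b.
  apply: hb; rewrite ?leq_maxl//.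
  by apply: (le_trans (normcD_leB _ (gauss_prod z m0))); rewrite addrC lerD2l ltW.
have := tail _ tK tb; have := tail _ zK hz.
have -> : rGamma (f t) - rGamma z = (rGamma (f t) - gauss_prod (f t) m)
   + (gauss_prod (f t) m - gauss_prod z m) - (rGamma z - gauss_prod z m) by ring.
have := normcB_le (rGamma (f t) - gauss_prod (f t) m
   + (gauss_prod (f t) m - gauss_prod z m)) (rGamma z - gauss_prod z m).
have := normcD_le (rGamma (f t) - gauss_prod (f t) m)
   (gauss_prod (f t) m - gauss_prod z m).
lra.
Unshelve. all: by end_near. Qed.

Lemma Gamma_real_neq0 (x : R) : 0 < x -> Gamma (x%:C) != 0.
Proof.
move=> x0; rewrite invr_eq0; apply/eqP => /rGamma_eq0[k].
rewrite -(rmorph_nat (real_complex R)) -rmorphN => /complexI xk.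
by move: x0; rewrite xk oppr_gt0 ltNge ler0n.
Qed.

End ReciprocalGamma.

(** * Atoms of the spectral measure *)

Section WeylAtoms.
Variables (R : realType) (alpha beta : R).
Implicit Types (z w d : R[i]) (e : R).

Local Notation c2 := (c2 alpha beta).
Local Notation c4 := (c4 alpha beta).

Lemma ccvg_c2 T (F : set_system T) {FF : ProperFilter F} (f : T -> R[i]) z :
  ccvg F f z -> ccvg F (fun t => c2 (f t)) (c2 z).
Proof.
move=> fz; apply: ccvgM; first (apply: ccvgM; first exact: ccvg_cst).
- by apply: ccvg_rGamma_comp; exact: (ccvgD fz (ccvg_cst _)).
- apply: ccvg_rGamma_comp.
  exact: (ccvgD (ccvgD (ccvgN fz) (ccvg_cst _)) (ccvg_cst _)).
Qed.

Lemma ccvg_c4 T (F : set_system T) {FF : ProperFilter F} (f : T -> R[i]) z :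
  ccvg F f z -> ccvg F (fun t => c4 (f t)) (c4 z).
Proof.
move=> fz; apply: ccvgM; first (apply: ccvgM; first exact: ccvg_cst).
- apply: ccvg_rGamma_comp.
  exact: (ccvgD (ccvgD fz (ccvg_cst _)) (ccvg_cst _)).
- by apply: ccvg_rGamma_comp; exact: (ccvgD (ccvgN fz) (ccvg_cst _)).
Qed.

(** The zeros of [c2] are those of its two reciprocal Gamma factors in z, namely z = - k - 1 and z =
    alpha + beta + k. They are real, and lambda is real at real z. *)
Lemma c2_neq0 z : 0 < alpha -> 0 < beta ->
  complex.Im (lambda_of alpha beta z) != 0 -> c2 z != 0.
Proof.
move=> a0 b0; apply: contraNneq => /eqP.
have real_root (x : R) : z = x%:C -> complex.Im (lambda_of alpha beta z) == 0.
  by move=> ->; rewrite /lambda_of/=; apply/eqP; ring.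
have ne (x : R) : 0 < x -> (x%:C : R[i]) == 0 = false.
  by move=> x0; rewrite eq_complex/= (gt_eqF x0).
rewrite /Defs.c2 !mulf_eq0 (ne _ b0) (ne _ (powR_gt0 _ (ltr0n _ 2))).
rewrite (negPf (Gamma_real_neq0 b0)) /=.
have -> : (Gamma (alpha%:C + 1) == 0) = false.
  apply/negbTE; rewrite -[1]/((1 : R)%:C) -rmorphD; apply: Gamma_real_neq0.
  by rewrite addr_gt0.
rewrite /= => /orP[] /eqP /rGamma_eq0[k zk].
- apply: (real_root (- k%:R - 1)).
  by rewrite rmorphB rmorphN rmorph_nat rmorph1 -zk; ring.
- apply: (real_root (alpha + beta + k%:R)).
  by rewrite !rmorphD rmorph_nat -[k%:R]opprK -zk; ring.
Qed.

(** The two roots have product - i e, so the smaller one has modulus at most sqrt e. No assumption d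
    <> 0 is made, so critical points of lambda are covered. *)
Lemma small_root d e : 0 <= e ->
  exists2 w, w * (w + d) = 0 +i* e & normc w ^+ 2 <= e.
Proof.
move=> e0; pose s := sqrtc (d ^+ 2 + 4 * (0 +i* e)).
have s2 : s ^+ 2 = d ^+ 2 + 4 * (0 +i* e) by rewrite /s sqr_sqrtc.
pose w1 := (- d + s) / 2; pose w2 := (- d - s) / 2.
have h1 : w1 * (w1 + d) = 0 +i* e.
  have -> : w1 * (w1 + d) = (s ^+ 2 - d ^+ 2) / 4 by rewrite /w1; field.
  by rewrite s2; field.
have h2 : w2 * (w2 + d) = 0 +i* e.
  have -> : w2 * (w2 + d) = (s ^+ 2 - d ^+ 2) / 4 by rewrite /w2; field.
  by rewrite s2; field.
have : normc w1 * normc w2 = e.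
  rewrite -ComplexField.Normc.normcM.
  have -> : w1 * w2 = - (w1 * (w1 + d)) by rewrite /w1 /w2; field.
  by rewrite h1 normc_opp /= expr0n add0r sqrtr_sqr ger0_norm.
have := normc_ge0 w1; have := normc_ge0 w2 => n2 n1 n12.
have [le|le] := leP (normc w1) (normc w2).
- by exists w1 => //; rewrite expr2 -n12 ler_wpM2l.
- by exists w2 => //; rewrite expr2 -n12 ler_wpM2r// ltW.
Qed.

Lemma atom_col_eigvec (Theta : 'M[R[i]]_2) (M : R[i] -> 'M[R[i]]_2)
    (A : 'M[R[i]]_2) (l : R) z : 0 < alpha -> 0 < beta ->
  weyl_function alpha beta Theta M ->
  (forall i j : 'I_2, ccvg (at_right (0 : R))
     (fun e : R => - (0 +i* 1) * (e%:C * M (l +i* e) i j)) (A i j)) ->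
  l%:C = lambda_of alpha beta z ->
  let v := eigvec alpha beta Theta z in
  forall j, v 1 0 * A 0 j = v 0 0 * A 1 j.
Proof.
move=> a0 b0 hM hA hl v j.
have FF : ProperFilter (at_right (0 : R)) by exact: at_right_proper_filter.
(* d is the derivative of lambda at z, and lambda(z + w) = lambda(z) + w (w + d) exactly. A small
   root w thus gives the path with lambda = l + i e. *)
pose d := z + z + 1 - alpha%:C - beta%:C.
have /choice[w hw] (e : R) : exists w, 0 <= e ->
    w * (w + d) = 0 +i* e /\ normc w ^+ 2 <= e.
  have [e0|] := boolP (0 <= e); last by exists 0.
  by have [x ? ?] := small_root d e0; exists x.
pose zz e := z + w e.
have lz e : 0 <= e -> lambda_of alpha beta (zz e) = l +i* e.
  move=> e0; have [he _] := hw _ e0.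
  have -> : lambda_of alpha beta (zz e) = lambda_of alpha beta z + w e * (w e + d).
    by rewrite /lambda_of /zz /d; ring.
  by rewrite he -hl; apply/eqP; rewrite eq_complex /= addr0 add0r !eqxx.
have czz : ccvg (at_right (0 : R)) zz z.
  apply/ccvgP => e e0; near=> t.
  have t0 : 0 < t by near: t; exact: nbhs_right_gt.
  have te : t < e ^+ 2 by near: t; apply: nbhs_right_lt; rewrite exprn_gt0.
  rewrite /zz addrC addKr -(ltr_pXn2r (n := 2)) ?nnegrE ?normc_ge0 ?(ltW e0)//.
  by apply: le_lt_trans te; have [] := hw _ (ltW t0).
have c2c : ccvg (at_right (0 : R)) (fun e => c2 (zz e)) (c2 z) by exact: ccvg_c2.
have c4c : ccvg (at_right (0 : R)) (fun e => c4 (zz e)) (c4 z) by exact: ccvg_c4.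
have cc0 : ccvg (at_right (0 : R)) (fun e => e%:C) (0%:C : R[i]).
  by split => /=; [exact: cvg_at_right_filter | exact: cvg_cst].
(* The first row of c2 (Theta - M_infinity), at the point z(e) of the path, times column j of - i e
   M_Theta. *)
pose lhs := fun e : R => (Theta 0 0 * c2 (zz e) + c4 (zz e)) *
    (- (0 +i* 1) * (e%:C * M (l +i* e) 0 j)) -
  (1 - Theta 0 1 * c2 (zz e)) * (- (0 +i* 1) * (e%:C * M (l +i* e) 1 j)).
have L1 : ccvg (at_right (0 : R)) lhs (v 1 0 * A 0 j - v 0 0 * A 1 j).
  have P1 : ccvg (at_right (0 : R)) (fun e => Theta 0 0 * c2 (zz e) + c4 (zz e))
      (Theta 0 0 * c2 z + c4 z).
    exact: (ccvgD (ccvgM (ccvg_cst _) c2c) c4c).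
  have P2 : ccvg (at_right (0 : R)) (fun e => 1 - Theta 0 1 * c2 (zz e))
      (1 - Theta 0 1 * c2 z).
    exact: (ccvgD (ccvg_cst _) (ccvgN (ccvgM (ccvg_cst _) c2c))).
  rewrite /v !mxE /=.
  exact: (ccvgD (ccvgM P1 (hA 0 j)) (ccvgN (ccvgM P2 (hA 1 j)))).
(* By the Weyl identity [lhs] is - i e c2 times the entry (0, j) of the identity matrix. Off the
   real axis c2 <> 0, which allows the denominators of [Minf] to be cleared. *)
have L2 : ccvg (at_right (0 : R)) lhs 0.
  have L3 : ccvg (at_right (0 : R))
      (fun e => (- (0 +i* 1) * (0 == j)%:R) * (e%:C * c2 (zz e))) 0.
    have -> : 0 = - (0 +i* 1) * (0 == j)%:R * (0%:C * c2 z) by rewrite mul0r mulr0.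
    exact: (ccvgM (ccvg_cst _) (ccvgM cc0 c2c)).
  apply/ccvgP => e e0; move/ccvgP : L3 => /(_ _ e0); apply: filter_app; near=> t.
  have t0 : 0 < t by near: t; exact: nbhs_right_gt.
  suff -> : lhs t = - (0 +i* 1) * (0 == j)%:R * (t%:C * c2 (zz t)) by [].
  have Im0 : complex.Im (lambda_of alpha beta (zz t)) != 0.
    by rewrite (lz _ (ltW t0))/= gt_eqF.
  have n0 := c2_neq0 a0 b0 Im0.
  have /matrixP /(_ 0 j) := hM _ Im0.
  rewrite (lz _ (ltW t0)) /lhs !mxE !big_ord_recl big_ord0 !mxE /= addr0.
  have -> : lift ord0 ord0 = 1 :> 'I_2 by apply/val_inj.
  move=> E; rewrite -E; move: (M _ _ _) (M _ _ _) => x y; field.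
  exact: n0.
by apply/eqP; rewrite -subr_eq0; apply/eqP; exact: (ccvg_unique L1 L2).
Unshelve. all: by end_near. Qed.

End WeylAtoms.

(** * Density matrices *)

Section DensityMatrix.
Local Open Scope sesquilinear_scope.

(** The integrand of [L2_norm2]. *)
Definition quad (R : realType) (D : 'M[R[i]]_2) (p : 'cV[R[i]]_2) : R :=
  complex.Re ((p ^t* *m D *m p) 0 0).

Variables (R : realType) (D : 'M[R[i]]_2).
Hypothesis psdD : forall v : 'cV[R[i]]_2, 0 <= (v ^t* *m D *m v) 0 0.
Hypothesis trD : \tr D = 1.
Implicit Types p q v : 'cV[R[i]]_2.

Lemma cvec2P p q : p 0 0 = q 0 0 -> p 1 0 = q 1 0 -> p = q.
Proof.
move=> h0 h1; apply/matrixP => i j; rewrite ord1.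
case: i => -[|[|//]] hi.
- by rewrite (_ : Ordinal hi = 0)//; apply: val_inj.
- by rewrite (_ : Ordinal hi = 1)//; apply: val_inj.
Qed.

Lemma mulmx2E p i : (D *m p) i 0 = D i 0 * p 0 0 + D i 1 * p 1 0.
Proof.
rewrite !mxE !big_ord_recl big_ord0 addr0.
by have -> : lift ord0 ord0 = 1 :> 'I_2 by apply: val_inj.
Qed.

Lemma mulmx2_formE p q : (p ^t* *m D *m q) 0 0 =
  conjc (p 0 0) * (D *m q) 0 0 + conjc (p 1 0) * (D *m q) 1 0.
Proof.
rewrite -mulmxA [LHS]mxE !big_ord_recl big_ord0 addr0.
have -> : lift ord0 ord0 = 1 :> 'I_2 by apply: val_inj.
by rewrite ![(p ^t*)%sesqui _ _]mxE !mxE.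
Qed.

Lemma tr2E : \tr D = D 0 0 + D 1 1.
Proof.
rewrite /mxtrace !big_ord_recl big_ord0 addr0.
by have -> : lift ord0 ord0 = 1 :> 'I_2 by apply: val_inj.
Qed.

Lemma density_repr : exists a b c : R,
  [/\ D 0 0 = a +i* 0, D 1 1 = (1 - a) +i* 0, D 0 1 = b +i* c
    & D 1 0 = b +i* - c].
Proof.
move: psdD trD; rewrite tr2E.
case E00 : (D 0 0) => [a a']; case E11 : (D 1 1) => [d d'].
case E01 : (D 0 1) => [b c]; case E10 : (D 1 0) => [b' c'].
move=> psd [ad _]; exists a, b, c.
have h x y : complex.Im (conjc x * ((a +i* a') * x + (b +i* c) * y) +
    conjc y * ((b' +i* c') * x + (d +i* d') * y)) = 0.
  have := psd (cvec2 x y); rewrite mulmx2_formE !mulmx2E !mxE/= E00 E01 E10 E11.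
  exact: ger0_Im.
have h1 := h 1 0; have h2 := h 0 1; have h3 := h 1 1; have h4 := h 1 'i.
move: h1 h2 h3 h4 => /= h1 h2 h3 h4.
split; apply/eqP; rewrite eq_complex/=; apply/andP; split; apply/eqP; lra.
Qed.

Lemma quad_ge0 p : 0 <= quad D p.
Proof. by have := psdD p; rewrite lecE => /andP[]. Qed.

(** For trace one, 1 - D is the adjugate of D, so |p|^2 - [quad D p] is the value of [quad D] at a
    vector orthogonal to p. *)
Lemma quad_le p : quad D p <= cnorm2 (p 0 0) + cnorm2 (p 1 0).
Proof.
rewrite -subr_ge0; apply: le_trans (quad_ge0 (cvec2 (- conjc (p 1 0)) (conjc (p 0 0)))) _.
rewrite /quad /cnorm2 !mulmx2_formE !mulmx2E !mxE /=.
have [a [b [c [-> -> -> ->]]]] := density_repr.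
case: (p 0 0) (p 1 0) => x y [x' y'] /=; rewrite le_eqVlt; apply/orP; left.
apply/eqP; ring.
Qed.

(** By Hermitian symmetry, Re p* D p = Re p* D q = Re q* D p = Re q* D q. *)
Lemma quad_congr p q : D *m p = D *m q -> quad D p = quad D q.
Proof.
move=> Dpq; have formC : complex.Re ((p ^t* *m D *m q) 0 0) =
    complex.Re ((q ^t* *m D *m p) 0 0).
  rewrite !mulmx2_formE !mulmx2E.
  have [a [b [c [-> -> -> ->]]]] := density_repr.
  case: (p 0 0) (p 1 0) => x y [x' y']; case: (q 0 0) (q 1 0) => s t [s' t'] /=.
  ring.
by rewrite /quad -mulmxA Dpq mulmxA formC -mulmxA Dpq mulmxA.
Qed.

(* quad p - |D p|^2 >= quad (p - D p) >= 0, as quad is bounded by |.|^2. *)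
Lemma quad_eq0 p : quad D p = 0 -> D *m p = 0.
Proof.
move=> p0; have h1 := quad_ge0 (p - D *m p); have h2 := quad_le (D *m p).
have E : quad D (p - D *m p) = quad D p -
    2 * (cnorm2 ((D *m p) 0 0) + cnorm2 ((D *m p) 1 0)) + quad D (D *m p).
  have sE i : (p - D *m p) i 0 = p i 0 - (D i 0 * p 0 0 + D i 1 * p 1 0).
    by rewrite mxE [X in _ + X]mxE mulmx2E.
  rewrite /quad /cnorm2 !mulmx2_formE !mulmx2E !sE.
  have [a [b [c [-> -> -> ->]]]] := density_repr.
  case: (p 0 0) (p 1 0) => x y [x' y'] /=; ring.
rewrite E p0 in h1.
have cn0 (x : R[i]) : 0 <= cnorm2 x by rewrite addr_ge0 ?sqr_ge0.
have cn (x : R[i]) : cnorm2 x <= 0 -> x = 0.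
  move=> x0; have /eqP : cnorm2 x = 0 by apply/eqP; rewrite eq_le x0 cn0.
  rewrite paddr_eq0 ?sqr_ge0// !sqrf_eq0 => /andP[/eqP r0 /eqP i0].
  by apply/eqP; rewrite eq_complex r0 i0 !eqxx.
have c0 := cn0 ((D *m p) 0 0); have c1 := cn0 ((D *m p) 1 0).
by apply: cvec2P; rewrite [RHS]mxE; apply: cn; lra.
Qed.

(** The hypothesis makes every column of D a multiple of v, so D = v r^T, where r is read off at a
    nonzero entry of v. Trace one then means r^T v = 1. *)
Lemma rank1_density v : v != 0 -> (forall j, v 1 0 * D 0 j = v 0 0 * D 1 j) ->
  D *m v = v /\ forall p, exists a, D *m p = a *: v.
Proof.
move=> v0 hv.
have [r hr] : exists r : 'I_2 -> R[i], forall i j, D i j = v i 0 * r j.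
  have [v00|v00] := eqVneq (v 0 0) 0.
    have v10 : v 1 0 != 0.
      by apply: contraNneq v0 => v10; apply/eqP/cvec2P; rewrite [RHS]mxE.
    exists (fun j => D 1 j / v 1 0) => i j.
    case: i => -[|[|//]] hi; [rewrite (_ : Ordinal hi = 0); last exact: val_inj
      |rewrite (_ : Ordinal hi = 1); last exact: val_inj].
    - by have := hv j; rewrite v00 !mul0r => /eqP; rewrite mulf_eq0 (negPf v10)/= => /eqP.
    - by rewrite mulrC divfK.
  exists (fun j => D 0 j / v 0 0) => i j.
  case: i => -[|[|//]] hi; [rewrite (_ : Ordinal hi = 0); last exact: val_inj
    |rewrite (_ : Ordinal hi = 1); last exact: val_inj].
  - by rewrite mulrC divfK.
  - by rewrite mulrA hv mulrAC mulfV// mul1r.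
have hD p : D *m p = (r 0 * p 0 0 + r 1 * p 1 0) *: v.
  by apply: cvec2P; rewrite mulmx2E !hr mxE; ring.
split; last by move=> p; exists (r 0 * p 0 0 + r 1 * p 1 0).
have -> : D *m v = (D 0 0 + D 1 1) *: v by rewrite hD !hr; congr (_ *: _); ring.
by rewrite -tr2E trD scale1r.
Qed.

End DensityMatrix.

(** * The space L^2(mu) *)

Section ComplexMeasurable.
Variable R : realType.
Implicit Types (A : set R) (f g : R -> R[i]).

Lemma cmeasurable_cst A (c : R[i]) : cmeasurable A (fun=> c).
Proof. by split; exact: measurable_cst. Qed.

Lemma cmeasurable_real A (g : R -> R) :
  measurable_fun A g -> cmeasurable A (fun x => (g x)%:C).
Proof. by split => //; exact: measurable_cst. Qed.

Lemma cmeasurableD A f g : cmeasurable A f -> cmeasurable A g ->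
  cmeasurable A (fun x => f x + g x).
Proof.
move=> [f1 f2] [g1 g2]; split.
- rewrite (_ : (fun x => _) = (fun x => complex.Re (f x)) \+ (fun x => complex.Re (g x))).
    exact: measurable_funD.
  by apply/funext => x /=; case: (f x) => ? ?; case: (g x).
- rewrite (_ : (fun x => _) = (fun x => complex.Im (f x)) \+ (fun x => complex.Im (g x))).
    exact: measurable_funD.
  by apply/funext => x /=; case: (f x) => ? ?; case: (g x).
Qed.

Lemma cmeasurableM A f g : cmeasurable A f -> cmeasurable A g ->
  cmeasurable A (fun x => f x * g x).
Proof.
move=> [f1 f2] [g1 g2]; split.
- rewrite (_ : (fun x => _) =
    (fun x => complex.Re (f x)) \* (fun x => complex.Re (g x)) \-
    (fun x => complex.Im (f x)) \* (fun x => complex.Im (g x))).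
    by apply: measurable_funB; exact: measurable_funM.
  by apply/funext => x /=; case: (f x) => ? ?; case: (g x).
- rewrite (_ : (fun x => _) =
    (fun x => complex.Re (f x)) \* (fun x => complex.Im (g x)) \+
    (fun x => complex.Im (f x)) \* (fun x => complex.Re (g x))).
    by apply: measurable_funD; exact: measurable_funM.
  by apply/funext => x /=; case: (f x) => ? ?; case: (g x).
Qed.

Lemma cmeasurable_conjc A f : cmeasurable A f -> cmeasurable A (fun x => conjc (f x)).
Proof.
move=> [f1 f2]; split.
- rewrite (_ : (fun x => _) = (fun x => complex.Re (f x)))//.
  by apply/funext => x /=; case: (f x).
- rewrite (_ : (fun x => _) = \- (fun x => complex.Im (f x))).
    exact: measurable_funN.
  by apply/funext => x /=; case: (f x).
Qed.

Lemma cmeasurable_sum A n (f : 'I_n -> R -> R[i]) :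
  (forall k, cmeasurable A (f k)) -> cmeasurable A (fun x => \sum_(k < n) f k x).
Proof.
elim: n f => [|n IH] f mf.
  rewrite (_ : (fun x => _) = fun=> 0); first exact: cmeasurable_cst.
  by apply/funext => x; rewrite big_ord0.
rewrite (_ : (fun x => _) = (fun x => f ord0 x + \sum_(k < n) f (lift ord0 k) x)).
  by apply: cmeasurableD => //; exact: IH.
by apply/funext => x; rewrite big_ord_recl.
Qed.

End ComplexMeasurable.

(** * Norms, null functions and membership in L^2(mu) *)

Section MatrixMeasureL2.
Local Open Scope sesquilinear_scope.
Variables (R : realType) (mu : matrix_measure R).
Local Notation tau := (mm_trace mu).
Local Notation D := (mm_dens mu).
Implicit Types phi psi : R -> 'cV[R[i]]_2.

Definition col_measurable phi := forall i, cmeasurable setT (fun x => phi x i 0).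

Lemma psd_dens x : forall v : 'cV[R[i]]_2, 0 <= (v ^t* *m D x *m v) 0 0.
Proof. by move=> v; exact: mm_psd. Qed.

Lemma tr_dens x : \tr (D x) = 1. Proof. exact: mm_tr1. Qed.

Lemma measurable_quad phi : col_measurable phi ->
  measurable_fun setT (fun x => quad (D x) (phi x)).
Proof.
move=> mphi; rewrite /quad.
suff [] : cmeasurable setT (fun x => ((phi x) ^t* *m D x *m phi x) 0 0) by [].
rewrite (_ : (fun x => _) = (fun x =>
  conjc (phi x 0 0) * (D x 0 0 * phi x 0 0 + D x 0 1 * phi x 1 0) +
  conjc (phi x 1 0) * (D x 1 0 * phi x 0 0 + D x 1 1 * phi x 1 0))); last first.
  by apply/funext => x; rewrite mulmx2_formE !mulmx2E.
by apply: cmeasurableD; apply: cmeasurableM; (try exact: cmeasurable_conjc);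
  apply: cmeasurableD; apply: cmeasurableM => //; exact: mm_measurable.
Qed.

Lemma L2_norm2_congr phi psi : col_measurable phi -> col_measurable psi ->
  L2_eq mu phi psi -> L2_norm2 mu phi = L2_norm2 mu psi.
Proof.
move=> mphi mpsi e; apply: ge0_ae_eq_integral => //.
- by apply/measurable_EFinP; exact: measurable_quad.
- by apply/measurable_EFinP; exact: measurable_quad.
- by move=> x _; rewrite lee_fin; exact: (quad_ge0 (@psd_dens x)).
- by move=> x _; rewrite lee_fin; exact: (quad_ge0 (@psd_dens x)).
- apply: filterS e => x ex _; congr (_%:E).
  exact: (quad_congr (@psd_dens x) (@tr_dens x) ex).
Qed.

Lemma L2_norm2_eq0 phi : col_measurable phi -> L2_norm2 mu phi = 0%E ->
  {ae tau, forall x, D x *m phi x = 0}.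
Proof.
move=> mphi n0.
have mq : measurable_fun setT (fun x => (quad (D x) (phi x))%:E).
  by apply/measurable_EFinP; exact: measurable_quad.
have := (ae_eq_integral_abs tau measurableT mq).1.
have -> : (\int[tau]_x `|(quad (D x) (phi x))%:E|)%E = L2_norm2 mu phi.
  apply: eq_integral => x _; rewrite abse_EFin ger0_norm//.
  exact: (quad_ge0 (@psd_dens x)).
move=> /(_ n0); apply: filterS => x /(_ I) [].
exact: (quad_eq0 (@psd_dens x) (@tr_dens x)).
Qed.

Lemma col_measurable_real (g : R -> R) (c : 'cV[R[i]]_2) :
  measurable_fun setT g -> col_measurable (fun x => (g x)%:C *: c).
Proof.
move=> mg i; rewrite (_ : (fun x => _) = (fun x => (g x)%:C * c i 0)).
  by apply: cmeasurableM; [exact: cmeasurable_real | exact: cmeasurable_cst].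
by apply/funext => x; rewrite mxE.
Qed.

Lemma quadZ x (g : R) (c : 'cV[R[i]]_2) :
  quad (D x) (g%:C *: c) = g ^+ 2 * quad (D x) c.
Proof.
rewrite /quad !mulmx2_formE !mulmx2E ![(_ *: c) _ _]mxE.
case: (c 0 0) (c 1 0) => a b [a' b'].
case: (D x 0 0) (D x 0 1) (D x 1 0) (D x 1 1) => [? ?] [? ?] [? ?] [? ?] /=; ring.
Qed.

(** The integrand is at most M^2 |c|^2 on B, by [quad_le], and vanishes elsewhere. This puts the
    test functions and the eigenvectors in L^2(mu). *)
Lemma L2_mem_bounded (g : R -> R) (c : 'cV[R[i]]_2) (B : set R) (M : R) :
  measurable_fun setT g -> measurable B -> (tau B < +oo)%E ->
  (forall x, `|g x| <= M * \1_B x) -> L2_mem mu (fun x => (g x)%:C *: c).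
Proof.
move=> mg mB tB gM; have mgc := col_measurable_real c mg; split => //.
set N := cnorm2 (c 0 0) + cnorm2 (c 1 0).
have N0 : 0 <= N by rewrite !addr_ge0 ?sqr_ge0.
have mi : measurable_fun setT (fun x : R => (M ^+ 2 * N * \1_B x)%:E).
  by apply/measurable_EFinP; apply: measurable_funM => //; exact: measurable_indic.
apply: (@le_lt_trans _ _ (\int[tau]_x (M ^+ 2 * N * \1_B x)%:E)%E).
  apply: ge0_le_integral => //.
  - by move=> x _; rewrite lee_fin; exact: (quad_ge0 (@psd_dens x)).
  - by apply/measurable_EFinP; exact: measurable_quad.
  - move=> x _; rewrite lee_fin -[leLHS]/(quad (D x) ((g x)%:C *: c)) quadZ.
    have qN := quad_le (@psd_dens x) (@tr_dens x) c.
    have q0 := quad_ge0 (@psd_dens x) c.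
    rewrite [leRHS]mulrAC ler_pM ?sqr_ge0//.
    move: (gM x); rewrite indicE; case: (x \in B); rewrite ?mulr1 ?mulr0 => gx.
      by rewrite -(real_normK (num_real (g x))) lerXn2r ?nnegrE// (le_trans _ gx).
    by move: gx; rewrite normr_le0 => /eqP->; rewrite expr0n.
under eq_integral do rewrite EFinM.
have MN0 : 0 <= M ^+ 2 * N by apply: mulr_ge0 => //; exact: sqr_ge0.
rewrite ge0_integralZl_EFin//; last first.
  by apply/measurable_EFinP; exact: measurable_indic.
by rewrite integral_indic// setIT lte_mul_pinfty// lee_fin.
Qed.

Lemma tau_set1_fin x : (tau [set x] < +oo)%E.
Proof. by rewrite -set_itv1; exact: mm_locally_finite. Qed.

(** A null set cannot contain a point of positive mass. *)
Lemma ae_at (P : R -> Prop) x :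
  {ae tau, forall y, P y} -> tau [set x] != 0%E -> P x.
Proof.
move=> [A [mA A0 PA]] x0; apply: contrapT => Px.
move/negP: x0; apply; rewrite -measure_le0 -A0.
apply: le_measure; rewrite ?inE//.
by move=> y -> ; apply: PA.
Qed.

End MatrixMeasureL2.

(** * Support of the spectral measure *)

Section WeightedL2.
Variables (R : realType) (alpha beta : R).
Implicit Types f g : R -> R[i].
Local Notation jinterval := (@jinterval R).
Local Notation H_norm2 := (H_norm2 alpha beta).
Local Notation inH := (inH alpha beta).

Lemma measurable_jinterval : measurable jinterval.
Proof. exact: measurable_itv. Qed.

Lemma measurable_H_integrand f : cmeasurable jinterval f ->
  measurable_fun jinterval (fun x => (cnorm2 (f x) * jweight alpha beta x)%:E).
Proof.
move=> [f1 f2]; apply/measurable_EFinP; apply: measurable_funM.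
  by apply: measurable_funD; exact: measurable_funX.
apply: measurable_funM; apply: measurable_funTS.
- apply: (@measurableT_comp _ _ _ _ _ _ (fun y : R => y `^ alpha)).
    exact: measurable_powR.
  by apply: measurable_funB => //; exact: measurable_cst.
- apply: (@measurableT_comp _ _ _ _ _ _ (fun y : R => y `^ beta)).
    exact: measurable_powR.
  by apply: measurable_funD => //; exact: measurable_cst.
Qed.

Lemma cnorm2_ge0 (w : R[i]) : 0 <= cnorm2 w.
Proof. by rewrite addr_ge0 ?sqr_ge0. Qed.

Lemma H_integrand_ge0 f x : (0 <= (cnorm2 (f x) * jweight alpha beta x)%:E)%E.
Proof. by rewrite lee_fin !mulr_ge0 ?cnorm2_ge0 ?powR_ge0. Qed.

Lemma H_norm2_congr f g : cmeasurable jinterval f -> cmeasurable jinterval g ->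
  eqH f g -> H_norm2 f = H_norm2 g.
Proof.
move=> mf mg fg; apply: ge0_ae_eq_integral.
- exact: measurable_jinterval.
- exact: measurable_H_integrand.
- exact: measurable_H_integrand.
- by move=> x _; exact: H_integrand_ge0.
- by move=> x _; exact: H_integrand_ge0.
- have fg' : {ae (@lebesgue_measure R), forall x, -1 < x < 1 -> f x = g x} := fg.
  apply: (@filterS _ _ (ae_filter_ringOfSetsType (@lebesgue_measure R)) _ _ _ fg').
  by move=> x fgx; rewrite /Defs.jinterval/= in_itv/= => /fgx ->.
Qed.

Lemma H_norm2_0 : H_norm2 (fun=> 0) = 0%E.
Proof.
rewrite /Defs.H_norm2 -[RHS](integral0 lebesgue_measure jinterval).
by apply: eq_integral => x _; rewrite /cnorm2/= expr0n addr0 mul0r.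
Qed.

(** Parallelogram law: the difference of the two sides is |c a - b|^2. *)
Lemma cnorm2_lin (c a b : R[i]) :
  cnorm2 (c * a + b) <= 2 * cnorm2 c * cnorm2 a + 2 * cnorm2 b.
Proof.
rewrite -subr_ge0; apply: le_trans (cnorm2_ge0 (c * a - b)) _.
rewrite /cnorm2; case: c a b => [x y] [x' y'] [s t] /=.
rewrite le_eqVlt; apply/orP; left; apply/eqP; ring.
Qed.

Lemma inH_lin (c : R[i]) f g : inH f -> inH g -> inH (fun x => c * f x + g x).
Proof.
move=> [mf nf] [mg ng]; have mfg : cmeasurable jinterval (fun x => c * f x + g x).
  by apply: cmeasurableD => //; apply: cmeasurableM => //; exact: cmeasurable_cst.
split => //.
have mm (k : R) h : cmeasurable jinterval h -> measurable_fun jinterval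
    (fun x => (k%:E * (cnorm2 (h x) * jweight alpha beta x)%:E)%E).
  by move=> mh; apply: measurable_funeM; exact: measurable_H_integrand.
apply: (@le_lt_trans _ _ (\int[lebesgue_measure]_(x in jinterval)
  ((2 * cnorm2 c)%:E * (cnorm2 (f x) * jweight alpha beta x)%:E +
   2%:E * (cnorm2 (g x) * jweight alpha beta x)%:E))%E).
  apply: ge0_le_integral.
  - exact: measurable_jinterval.
  - by move=> x _; exact: (H_integrand_ge0 (fun x => c * f x + g x)).
  - exact: (measurable_H_integrand mfg).
  - exact: (emeasurable_funD (mm _ _ mf) (mm _ _ mg)).
  - move=> x _; rewrite -!EFinM -EFinD lee_fin.
    have j0 : 0 <= jweight alpha beta x by rewrite mulr_ge0 ?powR_ge0.
    apply: (le_trans (ler_wpM2r j0 (cnorm2_lin c (f x) (g x)))).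
    by rewrite mulrDl -!mulrA.
have mI := measurable_jinterval.
have c2 : (0 <= (2 * cnorm2 c)%:E)%E by rewrite lee_fin mulr_ge0 ?cnorm2_ge0.
rewrite ge0_integralD//; first last.
- exact: mm.
- by move=> x _; rewrite mule_ge0 ?H_integrand_ge0// lee_fin.
- exact: mm.
- by move=> x _; rewrite mule_ge0 ?H_integrand_ge0.
have h0 h : forall x, jinterval x -> (0 <= (cnorm2 (h x) * jweight alpha beta x)%:E)%E.
  by move=> x _; exact: H_integrand_ge0.
rewrite (ge0_integralZl lebesgue_measure mI (measurable_H_integrand mf) (h0 f) c2).
rewrite (ge0_integralZl lebesgue_measure mI (measurable_H_integrand mg) (h0 g))//.
by rewrite lte_add_pinfty// lte_mul_pinfty.
Qed.

End WeightedL2.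

(** * Vanishing of mu near points of the resolvent set *)

Section SpectralSupport.
Local Open Scope sesquilinear_scope.
Variables (R : realType) (mu : matrix_measure R).
Local Notation tau := (mm_trace mu).
Local Notation D := (mm_dens mu).

Lemma dens_neq0 y : D y != 0.
Proof.
by apply/eqP => D0; have /eqP := mm_tr1 mu y; rewrite D0 mxtrace0 eq_sym oner_eq0.
Qed.

(* If the resolvent bound holds at x with constant C, then testing it with
   indicators of ]x - r, x + r[, where C r^2 < 1, shows that mu vanishes there. *)
Lemma resolvent_null (alpha beta : R) (dom : set (R -> R[i])) (x : R) :
  spectral_measure alpha beta dom mu -> dom `<=` Dmax alpha beta ->
  resolvent_set alpha beta dom x%:C ->
  exists2 r : R, 0 < r & {ae tau, forall y, ~ (x - r < y < x + r)}.
Proof.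
move=> [U [[UH Ulin Uiso Usurj] Udom Uell _]] hdom [_ [C C0 hC]].
(* With this r one has C r = 1 - r, hence C r^2 = r - r^2 < 1. *)
pose r : R := (C + 1)^-1.
have C1 : 0 < C + 1 by rewrite addr_gt0.
have r0 : 0 < r by rewrite invr_gt0.
have rC : r * (C + 1) = 1 by rewrite mulVf// gt_eqF.
have Cr : C * r ^+ 2 < 1.
  have Cr1 : C * r = 1 - r by move: rC; rewrite mulrDr mulr1 => <-; rewrite addrK mulrC.
  have r1 : r <= 1 by rewrite -subr_ge0 -Cr1 mulr_ge0// ltW.
  rewrite expr2 mulrA Cr1; clear -r0 r1; move: r r0 r1 => a a0 a1; nra.
exists r => //.
pose B : set R := `]x - r, x + r[%classic.
have mB : measurable B by exact: measurable_itv.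
have tB : (tau B < +oo)%E.
  apply: le_lt_trans (mm_locally_finite mu (x - r) (x + r)).
  apply: le_measure; rewrite ?inE//.
  by apply: subset_itvW; rewrite bnd_simp.
have m1B : measurable_fun setT (\1_B : R -> R) by exact: measurable_indic.
have mid : measurable_fun setT (fun y : R => y) by exact: measurable_id.
have xB y : \1_B y != 0 :> R -> `|y - x| <= r.
  rewrite indicE; case: (boolP (y \in B)) => [|_]; last by rewrite eqxx.
  rewrite inE /B/= in_itv/= => /andP[? ?] _; rewrite ler_norml; apply/andP; split; lra.
have null (c : 'cV[R[i]]_2) :
    {ae tau, forall y, D y *m ((\1_B y : R)%:C *: c) = 0}.
  (* phi is the test function and psi = (y - x) phi its image under the multiplication form of A -
     x. *)
  pose phi := fun y : R => (\1_B y : R)%:C *: c.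
  pose psi := fun y : R => ((y - x) * \1_B y : R)%:C *: c.
  have Lphi : L2_mem mu phi.
    apply: (@L2_mem_bounded _ _ _ c B 1 m1B mB tB) => y.
    by rewrite mul1r ger0_norm.
  have Lmul : L2_mem mu (mulvar phi).
    rewrite (_ : mulvar phi = fun y => (y * \1_B y : R)%:C *: c); last first.
      by apply/funext => y; rewrite /mulvar /phi scalerA rmorphM.
    apply: (@L2_mem_bounded _ _ _ c B (`|x| + r) _ mB tB).
      exact: measurable_funM.
    move=> y; rewrite normrM (@ger0_norm _ (\1_B y))//.
    have [->|/xB yx] := eqVneq (\1_B y : R) 0; first by rewrite !mulr0.
    rewrite ler_wpM2r// -[y](subrK x) (le_trans (ler_normD _ _))//.
    by rewrite addrC lerD2l.
  have Lpsi : L2_mem mu psi.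
    apply: (@L2_mem_bounded _ _ _ c B r _ mB tB).
      apply: measurable_funM => //; apply: measurable_funB => //.
    move=> y; rewrite normrM (@ger0_norm _ (\1_B y))//.
    have [->|/xB yx] := eqVneq (\1_B y : R) 0; first by rewrite !mulr0.
    by rewrite ler_wpM2r.
  have [f fH Uf] := Usurj _ Lphi.
  have mulm f' : inH alpha beta f' -> col_measurable (mulvar (U f')).
    move=> /UH[m _] i.
    rewrite (_ : (fun y => _) = (fun y => y%:C * U f' y i 0)).
      by apply: cmeasurableM => //; exact: cmeasurable_real.
    by apply/funext => y; rewrite mxE.
  have LmulU : L2_mem mu (mulvar (U f)).
    split; first exact: mulm.
    rewrite (@L2_norm2_congr _ _ _ (mulvar phi))//; [exact: Lmul.2|exact: mulm|exact: Lmul.1|].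
    apply: filterS Uf => y Ufy. by rewrite /mulvar -scalemxAr Ufy scalemxAr.
  have [g dg fg] := (Udom f fH).2 LmulU.
  have [gH _ _ _ lgH] := hdom _ dg.
  (* Compatibility of U with [eqH] follows from linearity and isometry: g - f has norm 0, hence so
     has its image. *)
  have Ug : L2_eq mu (U g) phi.
    pose h := fun y => -1 * f y + g y.
    have hH : inH alpha beta h by exact: inH_lin.
    have h0 : L2_norm2 mu (U h) = 0%E.
      rewrite (Uiso _ hH) -(H_norm2_0 alpha beta).
      apply: H_norm2_congr; [exact: hH.1|exact: cmeasurable_cst|].
      apply: (@filterS _ _ (ae_filter_ringOfSetsType (@lebesgue_measure R)) _ _ _ fg).
      by move=> y fgy /fgy fgy'; rewrite /h fgy' mulN1r addNr.
    have := L2_norm2_eq0 (UH _ hH).1 h0.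
    have := Ulin (-1) f g fH gH.
    move: Uf; apply: filterS3 => y Ufy lin Uh0; move: lin; rewrite Uh0.
    rewrite mulmxDr -scalemxAr Ufy scaleN1r addrC => /esym/eqP.
    by rewrite subr_eq0 => /eqP.
  (* k = (A - x) g has image psi, so the resolvent bound at g compares the squared norms of phi and
     psi. *)
  pose k := fun y => - x%:C * g y + jell alpha beta g y.
  have kH : inH alpha beta k by exact: inH_lin.
  have Uk : L2_eq mu (U k) psi.
    have := Ulin (- x%:C) g _ gH lgH; have := Uell _ dg.
    move: Ug; apply: filterS3 => y Ugy Ujy ->.
    rewrite mulmxDr Ujy /mulvar -!scalemxAr Ugy /psi /phi -!scalemxAr !scalerA -scalerDl.
    by congr (_ *: _); rewrite rmorphM rmorphB/=; ring.
  have := hC _ dg; rewrite -(Uiso _ gH).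
  rewrite (_ : (fun y => _) = k); last by apply/funext => y; rewrite /k; ring.
  rewrite -(Uiso _ kH) (L2_norm2_congr (UH _ gH).1 Lphi.1 Ug).
  rewrite (L2_norm2_congr (UH _ kH).1 Lpsi.1 Uk) => ineq.
  have n0 : (0 <= L2_norm2 mu phi)%E.
    by apply: integral_ge0 => y _; rewrite lee_fin; exact: (quad_ge0 (@psd_dens _ mu y)).
  have psi_le : (L2_norm2 mu psi <= (r ^+ 2)%:E * L2_norm2 mu phi)%E.
    rewrite /L2_norm2 -ge0_integralZl//; first last.
    - by rewrite lee_fin sqr_ge0.
    - by move=> y _; rewrite lee_fin; exact: (quad_ge0 (@psd_dens _ mu y)).
    - by apply/measurable_EFinP; exact: (@measurable_quad _ mu phi Lphi.1).
    apply: ge0_le_integral => //.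
    - by move=> y _; rewrite lee_fin; exact: (quad_ge0 (@psd_dens _ mu y)).
    - by apply/measurable_EFinP; exact: (@measurable_quad _ mu psi Lpsi.1).
    - apply: measurable_funeM.
      by apply/measurable_EFinP; exact: (@measurable_quad _ mu phi Lphi.1).
    move=> y _; rewrite -EFinM lee_fin.
    rewrite -[leLHS]/(quad (D y) (psi y)) -[X in _ * X]/(quad (D y) (phi y)) !quadZ.
    rewrite mulrA ler_wpM2r ?(quad_ge0 (@psd_dens _ mu y))// exprMn.
    have [->|/xB yx] := eqVneq (\1_B y : R) 0; first by rewrite expr0n !mulr0.
    rewrite ler_wpM2r ?sqr_ge0// -(real_normK (num_real (y - x))).
    by rewrite ler_pXn2r// nnegrE// ltW.
  apply: L2_norm2_eq0; first exact: Lphi.1.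
  have fin : L2_norm2 mu phi \is a fin_num by rewrite ge0_fin_numE//; exact: Lphi.2.
  move: ineq psi_le n0; rewrite -/phi -(fineK fin); set N := fine _.
  move=> ineq psi_le; rewrite lee_fin => N0; congr (_%:E); apply/eqP.
  (* The squared norm N of phi is finite and satisfies N <= C r^2 N with C r^2 < 1, so N = 0. *)
  have : (N%:E <= C%:E * ((r ^+ 2)%:E * N%:E))%E.
    by apply: (le_trans ineq); rewrite lee_pmul2l.
  rewrite -!EFinM lee_fin mulrA => NN; rewrite eq_le N0 andbT; nra.
(* Almost everywhere on B, D kills both basis vectors, hence is 0, against its trace being 1. *)
have := null (cvec2 0 1); have := null (cvec2 1 0).
apply: filterS2 => y h0 h1 /andP[y1 y2].
move/eqP : (dens_neq0 y); apply; apply/matrixP => i j; rewrite [RHS]mxE.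
have y1B : \1_B y = 1 :> R by rewrite indicE mem_set// /B/= in_itv/= y1.
have e0 : D y i 0 = 0.
  have := congr1 (fun A : 'cV_2 => A i 0) h0; rewrite y1B scale1r mulmx2E !mxE/=.
  by rewrite mulr1 mulr0 addr0.
have e1 : D y i 1 = 0.
  have := congr1 (fun A : 'cV_2 => A i 0) h1; rewrite y1B scale1r mulmx2E !mxE/=.
  by rewrite mulr1 mulr0 add0r.
case: j => -[|[|//]] hj.
- by rewrite (_ : Ordinal hj = 0)//; apply: val_inj.
- by rewrite (_ : Ordinal hj = 1)//; apply: val_inj.
Qed.

(** Every point outside S lies in a null interval with rational endpoints, and there are countably
    many of these. In the enumeration F, codes of no pair and of non-null intervals yield the empty
    set. *)
Lemma ae_of_locally_null (S : set R) :
  (forall x, ~ S x -> exists2 r : R, 0 < r & {ae tau, forall y, ~ (x - r < y < x + r)}) ->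
  {ae tau, forall y, S y}.
Proof.
move=> loc.
pose J (pq : rat * rat) : set R := [set y | ratr pq.1 < y < ratr pq.2].
pose F n : set R := if unpickle n is Some pq then
  if `[< tau.-negligible (J pq) >] then J pq else set0 else set0.
have F0 n : tau.-negligible (F n).
  rewrite /F; case: unpickle => [pq|]; last exact: negligible_set0.
  by case: ifP => [/asboolP//|_]; exact: negligible_set0.
apply: negligibleS (negligible_bigcup F0) => x /= /loc[r r0 xr].
have [p] := @rat_in_itvoo R (x - r) x (ltac:(by rewrite gtrBl)).
have [q] := @rat_in_itvoo R x (x + r) (ltac:(by rewrite ltrDl)).
rewrite !in_itv/= => /andP[q1 q2] /andP[p1 p2].
have nJ : tau.-negligible (J (p, q)).
  apply: negligibleS xr => y; rewrite /J /= => /andP[y1 y2]; apply.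
  by rewrite (lt_trans p1)// (lt_trans y2).
have : F (pickle (p, q)) = J (p, q).
  by rewrite /F pickleK; case: ifPn => // /asboolPn.
move: (pickle (p, q)) => n Fn; exists n; first exact: I.
by rewrite Fn /J /= p2.
Qed.

End SpectralSupport.

(** * Atomic measures *)

Section AtomicSpan.
Variables (R : realType) (mu : matrix_measure R).
Local Notation tau := (mm_trace mu).
Local Notation D := (mm_dens mu).

Definition atom_fun (lam : R) (v : 'cV[R[i]]_2) : R -> 'cV[R[i]]_2 :=
  fun x => (\1_[set lam] x : R)%:C *: v.

Lemma measurable_indic1 (l : R) : measurable_fun setT (\1_[set l] : R -> R).
Proof. exact: measurable_indic. Qed.

Lemma atom_fun_at l v : atom_fun l v l = v.
Proof. by rewrite /atom_fun indicE mem_set// scale1r. Qed.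

Lemma atom_fun_out l v x : x <> l -> atom_fun l v x = 0.
Proof. by move=> xl; rewrite /atom_fun indicE memNset ?scale0r. Qed.

Lemma atom_fun_L2 l v : L2_mem mu (atom_fun l v).
Proof.
apply: (@L2_mem_bounded _ _ _ v [set l] 1).
- exact: measurable_indic1.
- exact: measurable_set1.
- exact: tau_set1_fin.
- by move=> x; rewrite mul1r ger0_norm.
Qed.

Lemma mulvar_atom_fun l v : mulvar (atom_fun l v) = fun x => l%:C *: atom_fun l v x.
Proof.
apply/funext => x; rewrite /mulvar; have [->//|xl] := eqVneq x l.
by rewrite atom_fun_out ?scaler0//; exact/eqP.
Qed.

(** Since l has positive mass, D v <> 0 at that single point makes the function nonzero in
    L^2(mu). *)
Lemma atom_fun_eigenvector l v : tau [set l] != 0%E -> D l *m v != 0 ->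
  mul_eigenvector mu l (atom_fun l v).
Proof.
move=> t0 Dv; split.
- exact: atom_fun_L2.
- rewrite mulvar_atom_fun (_ : (fun x => _) = atom_fun l (l%:C *: v)).
    exact: atom_fun_L2.
  by apply/funext => x; rewrite /atom_fun !scalerA mulrC.
- move=> e; have : D l *m atom_fun l v l = D l *m 0 := ae_at e t0.
  rewrite atom_fun_at mulmx0 => /eqP.
  by rewrite (negPf Dv).
- by rewrite mulvar_atom_fun; apply: filterE.
Qed.

(** Away from l, the relation x D phi = l D phi forces D phi = 0. At l, the range of D is spanned by
    D v. *)
Lemma mul_eigenvector_atom_fun l v phi :
  (forall p, exists a, D l *m p = a *: (D l *m v)) ->
  mul_eigenvector mu l phi ->
  exists a : R[i], L2_eq mu phi (fun x => a *: atom_fun l v x).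
Proof.
move=> hv [_ _ _ e]; have [a ha] := hv (phi l); exists a.
apply: filterS e => x e.
have [->|xl] := eqVneq x l; first by rewrite atom_fun_at -scalemxAr ha.
have {}e : x%:C *: (D x *m phi x) = l%:C *: (D x *m phi x).
  by move: e; rewrite /mulvar -!scalemxAr.
rewrite atom_fun_out ?scaler0 ?mulmx0; last exact/eqP.
move/eqP : e; rewrite -subr_eq0 -scalerBl scaler_eq0 -rmorphB => /orP[|/eqP//].
by rewrite eq_complex/= eqxx andbT subr_eq0 (negPf xl).
Qed.

Variables (lam : nat -> R) (v : nat -> 'cV[R[i]]_2).
Hypothesis lam_ae : {ae tau, forall x, exists n, x = lam n}.
Hypothesis vP : forall n p, exists a, D (lam n) *m p = a *: (D (lam n) *m v n).
Local Notation f := (fun n => atom_fun (lam n) (v n)).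

(* lam need not be injective: coefficients are put on first occurrences only. *)
Lemma closed_span_atom_fun phi : L2_mem mu phi -> closed_span mu f phi.
Proof.
move=> Lphi; split=> // e e0.
have /choice[a0 ha] n := vP n (phi (lam n)).
pose a n := if [exists k : 'I_n, lam k == lam n] then 0 else a0 n.
pose S N x := \sum_(k < N) a k *: f k x.
have S0 N x : (forall k, (k < N)%N -> x <> lam k) -> S N x = 0.
  move=> xN; apply: big1 => k _; rewrite atom_fun_out ?scaler0//.
  exact: xN.
have SD N x : (exists2 k, (k < N)%N & x = lam k) -> D x *m S N x = D x *m phi x.
  elim: N => [|N IH] [k]; first by [].
  rewrite ltnS /S big_ord_recr/= -/(S N x) => kN xk.
  have [[k' k'N xk']|nex] := pselect (exists2 k, (k < N)%N & x = lam k).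
    (* If x already occurred, the new term adds nothing: either x is not [lam N], or [lam N] is a
       repetition and its coefficient is 0. *)
    suff -> : a N *: f N x = 0 by rewrite addr0; apply: IH; exists k'.
    have [xN|xN] := eqVneq x (lam N); last first.
      by rewrite atom_fun_out ?scaler0//; exact/eqP.
    rewrite /a ifT ?scale0r//; apply/existsP; exists (Ordinal k'N) => /=.
    by rewrite -xk' -xN.
  rewrite S0 ?add0r; last by move=> j jN xj; apply: nex; exists j.
  have kN' : k = N.
    by apply/eqP; move: kN; rewrite leq_eqVlt => /orP[//|kN]; case: nex; exists k.
  rewrite xk kN' atom_fun_at -scalemxAr /a ifF ?ha//.
  apply/negbTE/negP => /existsP[j /eqP jN]; apply: nex; exists j => //.
  by rewrite xk kN' jN.
(* The error density: 0 at the first N points and the density of phi elsewhere. It is thus dominated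
   by the latter and eventually 0 almost everywhere. *)
pose h N x := quad (D x) (phi x - S N x).
have h0 N x : 0 <= h N x by exact: (quad_ge0 (@psd_dens _ mu x)).
have hin N x : (exists2 k, (k < N)%N & x = lam k) -> h N x = 0.
  move=> xN; rewrite /h (@quad_congr _ _ (@psd_dens _ mu x) (@tr_dens _ mu x) _ 0).
    by rewrite /quad mulmx0 mxE.
  by rewrite mulmxBr SD// subrr mulmx0.
have hle N x : h N x <= quad (D x) (phi x).
  have [xN|xN] := pselect (exists2 k, (k < N)%N & x = lam k).
    by rewrite hin// (quad_ge0 (@psd_dens _ mu x)).
  by rewrite /h S0 ?subr0// => k kN xk; apply: xN; exists k.
have mS N : col_measurable (fun x => phi x - S N x).
  move=> i; rewrite (_ : (fun x => _) = (fun x => phi x i 0 +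
      \sum_(k < N) (- a k) * f k x i 0)).
    apply: cmeasurableD; first exact: Lphi.1.
    apply: cmeasurable_sum => k; apply: cmeasurableM; first exact: cmeasurable_cst.
    exact: (atom_fun_L2 (lam k) (v k)).1.
  apply/funext => x; rewrite mxE [X in _ + X]mxE /S summxE -sumrN.
  by congr (_ + _); apply: eq_bigr => k _; rewrite mxE mulNr.
have mh N : measurable_fun setT (fun x => (h N x)%:E).
  by apply/measurable_EFinP; exact: (@measurable_quad _ mu (fun x => phi x - S N x) (mS N)).
have mphi : measurable_fun setT (fun x => (quad (D x) (phi x))%:E).
  by apply/measurable_EFinP; exact: (@measurable_quad _ mu phi Lphi.1).
have hcvg : {ae tau, forall x, setT x -> (h N x)%:E @[N --> \oo] --> cst 0%E x}.
  apply: filterS lam_ae => x [n xn] _.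
  apply: cvg_near_cst; exists n.+1 => // N /= nN.
  by apply/eqP; rewrite /= hin//; exists n.
have iphi : tau.-integrable setT (fun x => (quad (D x) (phi x))%:E).
  apply/integrableP; split => //.
  rewrite (_ : (\int[_]_(_ in _) _)%E = L2_norm2 mu phi); first exact: Lphi.2.
  apply: eq_integral => x _; rewrite abse_EFin ger0_norm//.
  exact: (quad_ge0 (@psd_dens _ mu x)).
have hdom : {ae tau, forall x (N : nat), setT x ->
    (`|(h N x)%:E| <= (quad (D x) (phi x))%:E)%E}.
  by apply: filterE => x N _; rewrite abse_EFin lee_fin ger0_norm.
have [_ _] := dominated_convergence measurableT mh (measurable_cst _) hcvg iphi hdom.
rewrite integral_cst// mul0e => /= hlim.
have e2 : (0 < (e ^+ 2)%:E :> \bar R)%E by rewrite lte_fin exprn_gt0.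
have [N _ hN] := hlim _ (open_ereal_lt' e2).
by exists N, a; exact: (hN N (leqnn N)).
Qed.

End AtomicSpan.

(** * Eigenvectors and completeness in the spectral representation *)

Theorem corollary4p12 (R : realType) (alpha beta : R)
  (halpha : 0 < alpha < 1) (hbeta : 0 < beta < 1)
  (Theta : 'M[R[i]]_2) (hTheta : Theta \is hermsymmx)
  (* orientation of Gamma1 in the boundary condition, see dom_Theta *)
  (s : R) (hs : s = 1 \/ s = -1)
  (* A_Theta has discrete spectrum and its eigenvalues are the lam n *)
  (hdisc : discrete_spectrum alpha beta (dom_Theta alpha beta s Theta))
  (lam : nat -> R)
  (hlam : forall l : R[i],
     eigenvalue_of alpha beta (dom_Theta alpha beta s Theta) l <->
     exists n, l = (lam n)%:C)
  (z : nat -> R[i])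
  (hz : forall n, (lam n)%:C = lambda_of alpha beta (z n))
  (* mu is the spectral measure of A_Theta, related to M_Theta *)
  (mu : matrix_measure R)
  (hmu : spectral_measure alpha beta (dom_Theta alpha beta s Theta) mu)
  (M : R[i] -> 'M[R[i]]_2) (hM : weyl_function alpha beta Theta M)
  (hatom : forall (x : R) (i j : 'I_2),
     ccvg (at_right (0 : R))
       (fun e : R => - (0 +i* 1) * (e%:C * M (x +i* e) i j))
       (atom mu x i j))
  (* A_Theta is non-degenerate, with simple eigenvalues *)
  (hnd : nondegenerate_op alpha beta s Theta)
  (hsimple : forall n, \rank (atom mu (lam n)) = 1%N)
  (hother : forall x : R, (forall n, x <> lam n) -> \rank (atom mu x) = 0%N) :
  let f := fun (n : nat) (x : R) =>
    (\1_[set lam n] x : R)%:C *: eigvec alpha beta Theta (z n) in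
  (forall n, L2_mem mu (f n)) /\
  (forall n, eigvec alpha beta Theta (z n) <> 0 ->
     mul_eigenvector mu (lam n) (f n) /\
     forall phi, mul_eigenvector mu (lam n) phi ->
       exists a : R[i], L2_eq mu phi (fun x => a *: f n x)) /\
  ((forall n, eigvec alpha beta Theta (z n) <> 0) ->
     [set phi | L2_mem mu phi] = closed_span mu f).
Proof.
move=> f; have [a0 _] := andP halpha; have [b0 _] := andP hbeta.
pose v n := eigvec alpha beta Theta (z n).
have fE : f = fun n => atom_fun (lam n) (v n) by [].
have tau0 n : (fine (mm_trace mu [set lam n]))%:C != 0 :> R[i].
  by apply/eqP => t0; have := hsimple n; rewrite /atom t0 scale0r mxrank0.
have tau_neq0 n : mm_trace mu [set lam n] != 0%E.
  by apply: contraNneq (tau0 n) => ->.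
(* v_n = 0 means that the first row of c2 (Theta - M_infinity) vanishes at z_n, whereas degeneracy
   also prescribes the entry Theta_22. So v_n <> 0 is a condition of its own here. The mass of the
   atom is cancelled to pass from the atom to its density. *)
have atomP n : v n <> 0 -> mm_dens mu (lam n) *m v n = v n /\
    forall p, exists a, mm_dens mu (lam n) *m p = a *: v n.
  move=> /eqP v0; apply: (rank1_density (@tr_dens _ mu (lam n)) v0) => j.
  apply: (mulfI (tau0 n)).
  have := atom_col_eigvec a0 b0 hM (hatom (lam n)) (hz n) j.
  by rewrite /atom !mxE => E; rewrite mulrCA E; ring.
split; first by move=> n; exact: atom_fun_L2.
split=> [n vn|vne].
  have [Dv Dp] := atomP n vn; split.
    by apply: atom_fun_eigenvector => //; rewrite Dv; exact/eqP.
  by move=> phi; apply: mul_eigenvector_atom_fun => p; rewrite Dv.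
apply/seteqP; split => phi; last by case.
apply: closed_span_atom_fun => [|n p].
  (* A real point outside the spectrum's list of eigenvalues is in the resolvent set, as the
     spectrum is discrete, so mu vanishes near it. *)
  apply: ae_of_locally_null => x xlam.
  apply: (resolvent_null hmu) => [g []//|].
  apply: contrapT => /hdisc[/hlam[n /complexI xn] _ _].
  by apply: xlam; exists n.
by have [Dv Dp] := atomP n (vne n); rewrite Dv.
Qed.
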